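(* Let $f:\mathbb{C}\to\mathbb{C}$ be a transcendental entire function with an omitted value $\beta\in\mathbb{C}$, and let $n\in\mathbb{N}$. For $R>0$ define the annulus $$A_R:=\{z\in\mathbb{C} : R/2<|z-\beta|<2R\}.$$ Then there exist $\delta>0$ and $R=R(n)>0$ such that $f(A_R)\supset A_R$ and every point in $A_R$ has at least $n$ preimages under $f$ in $A_R$ which are at Euclidean distance at least $\delta$ from each other.
   Context: A transcendental entire function is a holomorphic function $f:\mathbb{C}\to\mathbb{C}$ that is not a polynomial. A value $\beta\in\mathbb{C}$ is an omitted value of $f$ if $f(z)\neq\beta$ for all $z\in\mathbb{C}$. *)

(* Defs.v *)
From Stdlib Require Import Reals.
From Coquelicot Require Import Coquelicot.

(* Complex differentiability: the scalars are [C_AbsRing], not [R_AbsRing]. *)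
Definition entire (f : C -> C) : Prop :=
  forall z : C, @ex_derive C_AbsRing C_NormedModule f z.

(* [sum_n u d] is u 0 + ... + u d. *)
Definition polynomial_function (f : C -> C) : Prop :=
  exists (d : nat) (a : nat -> C),
    forall z : C, f z = sum_n (fun k : nat => (a k * Cpow z k)%C) d.

Definition transcendental_entire (f : C -> C) : Prop :=
  entire f /\ ~ polynomial_function f.

Definition omitted_value (f : C -> C) (beta : C) : Prop :=
  forall z : C, f z <> beta.

Definition annulus (beta : C) (r : R) (z : C) : Prop :=
  (r / 2 < Cmod (z - beta) < 2 * r)%R.

(* Main.v *)
Require Import Defs.
From Stdlib Require Import ZArith Reals Lra Lia Classical ClassicalEpsilon.
From Coquelicot Require Import Coquelicot.
Open Scope R_scope.

(** Translating by [beta], the function [f] omits [0] and is not constant, so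
    [f = exp g] with [g] entire and not constant. The solutions of [f z = w] are the
    points where [g] takes one of the values [zeta + 2 pi i k], where [exp zeta = w].
    For [w] in the annulus of radius [R] these values lie on a vertical line of abscissa
    close to [log R]. It is enough that the [g]-image of the annulus contain [n] of them
    for every such line: distinct values are at least [2 pi] apart, and [g] is Lipschitz on
    the disc of radius [2 R], which separates the preimages.

    The image of [g] is found far up the line, where [|k|] is of the order of the maximum
    modulus [M] of [g]. Choose a point [z0] of modulus [R] at which [|g|], weighted by a
    suitable function of [|z|], is nearly maximal ([extremal_point]). In the coordinate
    [s = log z] the weight makes [|g|] grow no faster near [z0] than
    [exp (a * (Re s - Re s0))], up to a factor close to [1], for some rate [a >= 1/2] and on
    a vertical strip of width comparable to [1 / a]. The quotient
    [h] of [g] by [g(z0) exp (a (s - s0))] is thus holomorphic, takes the value [1], and has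
    modulus hardly above [1] in a whole strip; [strip_rigidity] makes it nearly constant
    on long pieces of the strip. Hence [g] resembles [z |-> c z^a] and covers a whole
    annulus around [|w| = M] ([annulus_image]). A nonconstant entire function outgrows
    [sqrt |z|] ([liouville_sqrt_growth]), so [M] may be taken far larger than [log R] and
    [n], and the vertical line crosses the covered annulus in a segment long enough for [n]
    of the required values ([many_preimages]).

    The function theory rests on a single integral identity, Goursat's theorem for
    rectangles ([goursat]). Applied in logarithmic coordinates, it says that circle means
    do not depend on the radius, which yields the estimate
    [|h'(p)| <= 4 (M - Re h(p)) / T] when [Re h <= M] on the disc of radius [T] about [p]
    ([borel_caratheodory]). From this follow Cauchy's estimate, the holomorphy of
    derivatives, Liouville's theorem and, because the right-hand side is small where [Re h]
    is nearly maximal, the rigidity in a strip through a differential inequality. *)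

(** * Complex differentiability *)

(** Complex derivative with the error measured by [Cmod], the form in which every
    estimate below consumes it. *)
Definition cderiv (f : C -> C) (z l : C) : Prop :=
  forall eps : R, 0 < eps -> exists del : R, 0 < del /\
    forall h : C, Cmod h < del ->
      Cmod (f (z + h) - f z - l * h)%C <= eps * Cmod h.

(** The filter in [is_derive] is the neighbourhood filter of [Cmod], so only the
    rewriting of [z + h - z] to [h] separates the two notions. *)
Lemma cderiv_of_is_derive (f : C -> C) (z l : C) :
  @is_derive C_AbsRing C_NormedModule f z l -> cderiv f z l.
Proof.
  intros [_ H] eps Heps.
  destruct (H z (fun P HP => HP) (mkposreal eps Heps)) as [del Hdel].
  exists del; split; [apply cond_pos|]; intros h Hh.
  specialize (Hdel (z + h)%C).
  replace (l * h)%C with ((z + h - z) * l)%C by ring.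
  replace (Cmod h) with (Cmod (z + h - z)%C) by (f_equal; ring).
  apply Hdel.
  change (Cmod (z + h - z)%C < del).
  replace (z + h - z)%C with h by ring; exact Hh.
Qed.

Lemma cderiv_ext (f g : C -> C) (z l : C) :
  (forall w, f w = g w) -> cderiv f z l -> cderiv g z l.
Proof.
  intros E H eps Heps; destruct (H eps Heps) as [d [Hd K]].
  exists d; split; auto; intros h Hh; rewrite <- !E; auto.
Qed.

Lemma cderiv_eq (f : C -> C) (z l m : C) : l = m -> cderiv f z l -> cderiv f z m.
Proof. now intros ->. Qed.

Lemma Cplus_minus (a b : C) : (a + (b - a))%C = b.
Proof. ring. Qed.

Lemma Cmod_triangle3 (a b c : C) : Cmod (a + b + c)%C <= Cmod a + Cmod b + Cmod c.
Proof.
  pose proof (Cmod_triangle (a + b)%C c); pose proof (Cmod_triangle a b); lra.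
Qed.

Lemma Cmod_minus_sym (a b : C) : Cmod (a - b)%C = Cmod (b - a)%C.
Proof. rewrite <- Cmod_opp; f_equal; ring. Qed.

Lemma Cmod_sub_triangle (a b c : C) : Cmod (a - c)%C <= Cmod (a - b)%C + Cmod (b - c)%C.
Proof. replace (a - c)%C with ((a - b) + (b - c))%C by ring; apply Cmod_triangle. Qed.

Lemma Cmod_le_add_sub (a b : C) : Cmod a <= Cmod b + Cmod (a - b)%C.
Proof.
  pose proof (Cmod_triangle b (a - b)%C) as H.
  replace (b + (a - b))%C with a in H by ring; exact H.
Qed.

Lemma cderiv_increment (f : C -> C) (z l : C) : cderiv f z l ->
  exists d, 0 < d /\ forall h, Cmod h < d ->
    Cmod (f (z + h) - f z)%C <= (Cmod l + 1) * Cmod h.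
Proof.
  intros H; destruct (H 1 Rlt_0_1) as [d [Hd K]].
  exists d; split; auto; intros h Hh; specialize (K h Hh).
  pose proof (Cmod_le_add_sub (f (z + h) - f z)%C (l * h)%C) as T.
  rewrite Cmod_mult in T; lra.
Qed.

Lemma cderiv_continuous (f : C -> C) (z l : C) : cderiv f z l ->
  forall eps, 0 < eps -> exists d, 0 < d /\ forall h, Cmod h < d ->
    Cmod (f (z + h) - f z)%C <= eps.
Proof.
  intros H eps Heps; destruct (cderiv_increment _ _ _ H) as [d [Hd K]].
  pose proof (Cmod_ge_0 l) as Hl.
  assert (Hq : 0 < eps / (Cmod l + 1)) by (apply Rdiv_lt_0_compat; lra).
  exists (Rmin d (eps / (Cmod l + 1))); split; [now apply Rmin_pos|].
  intros h Hh; apply Rle_trans with (1 := K h (Rlt_le_trans _ _ _ Hh (Rmin_l _ _))).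
  assert (Hh' : Cmod h < eps / (Cmod l + 1))
    by (apply Rlt_le_trans with (1 := Hh); apply Rmin_r).
  apply Rlt_le in Hh'; apply Rmult_le_compat_l with (r := Cmod l + 1) in Hh'; [|lra].
  replace ((Cmod l + 1) * (eps / (Cmod l + 1))) with eps in Hh' by (field; lra); lra.
Qed.

Lemma cderiv_const (c z : C) : cderiv (fun _ => c) z 0.
Proof.
  intros eps Heps; exists 1; split; [lra|]; intros h _.
  replace (c - c - 0 * h)%C with (RtoC 0) by ring; rewrite Cmod_0.
  pose proof (Cmod_ge_0 h); nra.
Qed.

Lemma cderiv_id (z : C) : cderiv (fun w => w) z 1.
Proof.
  intros eps Heps; exists 1; split; [lra|]; intros h _.
  replace (z + h - z - 1 * h)%C with (RtoC 0) by ring; rewrite Cmod_0.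
  pose proof (Cmod_ge_0 h); nra.
Qed.

Lemma cderiv_plus (f g : C -> C) (z l m : C) :
  cderiv f z l -> cderiv g z m -> cderiv (fun w => f w + g w)%C z (l + m)%C.
Proof.
  intros Hf Hg eps Heps.
  destruct (Hf (eps / 2)) as [d1 [H1 K1]]; [lra|].
  destruct (Hg (eps / 2)) as [d2 [H2 K2]]; [lra|].
  exists (Rmin d1 d2); split; [now apply Rmin_pos|]; intros h Hh.
  specialize (K1 h (Rlt_le_trans _ _ _ Hh (Rmin_l _ _))).
  specialize (K2 h (Rlt_le_trans _ _ _ Hh (Rmin_r _ _))).
  replace (f (z + h) + g (z + h) - (f z + g z) - (l + m) * h)%C
    with ((f (z + h) - f z - l * h) + (g (z + h) - g z - m * h))%C by ring.
  pose proof (Cmod_triangle (f (z + h) - f z - l * h)%C (g (z + h) - g z - m * h)%C); lra.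
Qed.

Lemma cderiv_mult (f g : C -> C) (z l m : C) :
  cderiv f z l -> cderiv g z m ->
  cderiv (fun w => f w * g w)%C z (l * g z + f z * m)%C.
Proof.
  intros Hf Hg eps Heps.
  pose proof (Cmod_ge_0 (f z)) as F0; pose proof (Cmod_ge_0 (g z)) as G0;
  pose proof (Cmod_ge_0 l) as L0.
  destruct (Hf (eps / (3 * (Cmod (g z)%C + 1)))) as [d1 [H1 K1]];
    [apply Rdiv_lt_0_compat; lra|].
  destruct (Hg (eps / (3 * (Cmod (f z)%C + 1)))) as [d2 [H2 K2]];
    [apply Rdiv_lt_0_compat; lra|].
  destruct (cderiv_continuous _ _ _ Hg (Rmin 1 (eps / (3 * (Cmod l + 1)))))
    as [d3 [H3 K3]]; [apply Rmin_pos; [lra|apply Rdiv_lt_0_compat; lra]|].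
  exists (Rmin d1 (Rmin d2 d3)); split; [repeat apply Rmin_pos; auto|]; intros h Hh.
  assert (Cmod h < d1 /\ Cmod h < d2 /\ Cmod h < d3) as [h1 [h2 h3]].
  { pose proof (Rmin_l d1 (Rmin d2 d3)); pose proof (Rmin_r d1 (Rmin d2 d3));
    pose proof (Rmin_l d2 d3); pose proof (Rmin_r d2 d3); lra. }
  specialize (K1 h h1); specialize (K2 h h2); specialize (K3 h h3).
  set (A := (f (z + h) - f z - l * h)%C) in *.
  set (B := (g (z + h) - g z - m * h)%C) in *.
  set (D := (g (z + h) - g z)%C) in *.
  replace (f (z + h) * g (z + h) - f z * g z - (l * g z + f z * m) * h)%C
    with (A * (g z + D) + l * h * D + f z * B)%C by (unfold A, B, D; ring).
  pose proof (Rmin_l 1 (eps / (3 * (Cmod l + 1)))) as M1.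
  pose proof (Rmin_r 1 (eps / (3 * (Cmod l + 1)))) as M2.
  apply Rle_trans with (1 := Cmod_triangle3 _ _ _); rewrite !Cmod_mult.
  pose proof (Cmod_ge_0 h) as h0.
  assert (T1 : Cmod A * Cmod (g z + D)%C <= eps / 3 * Cmod h).
  { apply Rle_trans with
      (eps / (3 * (Cmod (g z)%C + 1)) * Cmod h * (Cmod (g z)%C + 1)).
    - apply Rmult_le_compat; try apply Cmod_ge_0; auto.
      pose proof (Cmod_triangle (g z)%C D); lra.
    - apply Req_le; field; lra. }
  assert (T2 : Cmod l * Cmod h * Cmod D <= eps / 3 * Cmod h).
  { apply Rle_trans with ((Cmod l + 1) * Cmod h * (eps / (3 * (Cmod l + 1)))).
    - apply Rmult_le_compat; try apply Cmod_ge_0; [|nra|lra].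
      apply Rmult_le_pos; auto.
    - apply Req_le; field; lra. }
  assert (T3 : Cmod (f z)%C * Cmod B <= eps / 3 * Cmod h).
  { apply Rle_trans with
      ((Cmod (f z)%C + 1) * (eps / (3 * (Cmod (f z)%C + 1)) * Cmod h)).
    - apply Rmult_le_compat; try apply Cmod_ge_0; auto; lra.
    - apply Req_le; field; lra. }
  lra.
Qed.

Lemma cderiv_scal (c : C) (f : C -> C) (z l : C) :
  cderiv f z l -> cderiv (fun w => c * f w)%C z (c * l)%C.
Proof.
  intros H; apply (cderiv_eq _ _ (0 * f z + c * l)%C); [ring|].
  apply (cderiv_mult (fun _ => c) f); auto using cderiv_const.
Qed.

Lemma cderiv_minus (f g : C -> C) (z l m : C) :
  cderiv f z l -> cderiv g z m -> cderiv (fun w => f w - g w)%C z (l - m)%C.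
Proof.
  intros Hf Hg; apply (cderiv_ext (fun w => f w + (- (1)) * g w)%C);
    [intros; ring|].
  apply (cderiv_eq _ _ (l + (- (1)) * m)%C); [ring|].
  apply cderiv_plus; auto; now apply cderiv_scal.
Qed.

Lemma cderiv_comp (f g : C -> C) (z l m : C) :
  cderiv g z l -> cderiv f (g z) m -> cderiv (fun w => f (g w)) z (m * l)%C.
Proof.
  intros Hg Hf eps Heps.
  pose proof (Cmod_ge_0 l) as L0; pose proof (Cmod_ge_0 m) as M0.
  destruct (Hf (eps / (2 * (Cmod l + 1)))) as [d1 [H1 K1]];
    [apply Rdiv_lt_0_compat; lra|].
  destruct (Hg (eps / (2 * (Cmod m + 1)))) as [d2 [H2 K2]];
    [apply Rdiv_lt_0_compat; lra|].
  destruct (cderiv_increment _ _ _ Hg) as [d3 [H3 K3]].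
  destruct (cderiv_continuous _ _ _ Hg (d1 / 2)) as [d4 [H4 K4]]; [lra|].
  exists (Rmin d2 (Rmin d3 d4)); split; [repeat apply Rmin_pos; auto|]; intros h Hh.
  assert (Cmod h < d2 /\ Cmod h < d3 /\ Cmod h < d4) as [h2 [h3 h4]].
  { pose proof (Rmin_l d2 (Rmin d3 d4)); pose proof (Rmin_r d2 (Rmin d3 d4));
    pose proof (Rmin_l d3 d4); pose proof (Rmin_r d3 d4); lra. }
  specialize (K2 h h2); specialize (K3 h h3); specialize (K4 h h4).
  set (k := (g (z + h) - g z)%C) in *.
  assert (k1 : Cmod k < d1) by lra; specialize (K1 k k1).
  replace (g (z + h)%C) with (g z + k)%C by (unfold k; ring).
  replace (f (g z + k) - f (g z) - m * l * h)%C
    with ((f (g z + k) - f (g z) - m * k) + m * (k - l * h))%C by ring.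
  apply Rle_trans with (1 := Cmod_triangle _ _); rewrite Cmod_mult.
  pose proof (Cmod_ge_0 h) as h0.
  assert (T1 : Cmod (f (g z + k) - f (g z) - m * k)%C <= eps / 2 * Cmod h).
  { apply Rle_trans with (1 := K1).
    apply Rle_trans with (eps / (2 * (Cmod l + 1)) * ((Cmod l + 1) * Cmod h)).
    - apply Rmult_le_compat_l; auto; apply Rlt_le, Rdiv_lt_0_compat; lra.
    - apply Req_le; field; lra. }
  assert (T2 : Cmod m * Cmod (k - l * h)%C <= eps / 2 * Cmod h).
  { apply Rle_trans with ((Cmod m + 1) * (eps / (2 * (Cmod m + 1)) * Cmod h)).
    - apply Rmult_le_compat; try apply Cmod_ge_0; auto; lra.
    - apply Req_le; field; lra. }
  lra.
Qed.

Lemma cderiv_inv (z : C) : z <> 0 -> cderiv (fun w => / w)%C z (- / (z * z))%C.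
Proof.
  intros Hz eps Heps; pose proof (proj1 (Cmod_gt_0 z) Hz) as Z0.
  assert (Q : 0 < eps * (Cmod z * Cmod z * (Cmod z / 2)))
    by (repeat apply Rmult_lt_0_compat; lra).
  exists (Rmin (Cmod z / 2) (eps * (Cmod z * Cmod z * (Cmod z / 2)))).
  split; [apply Rmin_pos; auto; lra|]; intros h Hh.
  assert (Cmod h < Cmod z / 2 /\ Cmod h < eps * (Cmod z * Cmod z * (Cmod z / 2)))
    as [h1 h2].
  { pose proof (Rmin_l (Cmod z / 2) (eps * (Cmod z * Cmod z * (Cmod z / 2))));
    pose proof (Rmin_r (Cmod z / 2) (eps * (Cmod z * Cmod z * (Cmod z / 2)))); lra. }
  assert (W : Cmod z / 2 <= Cmod (z + h)%C).
  { pose proof (Cmod_le_add_sub z (z + h)%C) as T.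
    replace (z - (z + h))%C with (- h)%C in T by ring; rewrite Cmod_opp in T; lra. }
  assert (Hw : (z + h)%C <> 0) by (apply Cmod_gt_0; lra).
  replace (/ (z + h) - / z - - / (z * z) * h)%C with (h * h / (z * z * (z + h)))%C
    by (field; auto).
  rewrite Cmod_div by (repeat apply Cmult_neq_0; auto).
  rewrite !Cmod_mult; pose proof (Cmod_ge_0 h) as h0.
  apply Rle_div_l; [repeat apply Rmult_lt_0_compat; lra|].
  apply Rle_trans with (eps * (Cmod z * Cmod z * (Cmod z / 2)) * Cmod h); [nra|].
  assert (0 < eps * (Cmod z * Cmod z)) by (repeat apply Rmult_lt_0_compat; lra).
  replace (eps * Cmod h * (Cmod z * Cmod z * Cmod (z + h)%C))
    with (eps * (Cmod z * Cmod z) * Cmod (z + h)%C * Cmod h) by ring.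
  apply Rmult_le_compat_r; auto.
  rewrite <- Rmult_assoc; apply Rmult_le_compat_l; lra.
Qed.

(** Complex derivatives enter real calculus through the real part along a line; the
    imaginary part is the real part of [- Ci * f], so this one rule serves both. *)
Lemma is_derive_Re_line (f : C -> C) (p v l : C) (t : R) :
  cderiv f (p + t * v) l ->
  is_derive (fun u : R => Re (f (p + u * v))%C) t (Re (l * v)%C).
Proof.
  intros H; apply is_derive_Reals; intros eps Heps.
  pose proof (Cmod_ge_0 v) as V0.
  destruct (H (eps / (2 * (Cmod v + 1)))) as [d [Hd K]];
    [apply Rdiv_lt_0_compat; lra|].
  assert (Q : 0 < d / (Cmod v + 1)) by (apply Rdiv_lt_0_compat; lra).
  exists (mkposreal _ Q); intros h Hh0 Hh; simpl in Hh.
  pose proof (Rabs_pos_lt h Hh0) as HA.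
  assert (E : Cmod (h * v)%C = Rabs h * Cmod v) by (now rewrite Cmod_mult, Cmod_R).
  assert (L : Cmod (h * v)%C < d).
  { rewrite E; apply Rle_lt_trans with (Rabs h * (Cmod v + 1)); [nra|].
    apply Rlt_div_r; lra. }
  specialize (K _ L); rewrite E in K.
  replace (p + (t + h)%R * v)%C with (p + t * v + h * v)%C
    by (rewrite RtoC_plus; ring).
  set (A := f (p + t * v + h * v)%C) in *; set (B := f (p + t * v)%C) in *.
  replace ((Re A - Re B) / h - Re (l * v)%C) with (Re (A - B - l * (h * v))%C / h).
  2:{ destruct A, B, l, v; simpl; field; auto. }
  unfold Rdiv; rewrite Rabs_mult, Rabs_inv.
  pose proof (re_le_Cmod (A - B - l * (h * v))%C) as T.
  apply Rmult_lt_reg_r with (Rabs h); auto.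
  rewrite Rmult_assoc, Rinv_l, Rmult_1_r by lra.
  apply Rle_lt_trans with (1 := T); apply Rle_lt_trans with (1 := K).
  apply Rle_lt_trans with (eps / (2 * (Cmod v + 1)) * (Rabs h * (Cmod v + 1))).
  { apply Rmult_le_compat_l; [apply Rlt_le, Rdiv_lt_0_compat; lra|nra]. }
  replace (eps / (2 * (Cmod v + 1)) * (Rabs h * (Cmod v + 1))) with (eps * Rabs h / 2)
    by (field; lra).
  nra.
Qed.

(** Differentiability at every point of the plane, with no regularity asked of the
    derivative: that is recovered from Goursat's argument in [holomorphic_derivative]. *)
Definition holomorphic (f : C -> C) : Prop := forall z, exists l, cderiv f z l.

Lemma holomorphic_const (c : C) : holomorphic (fun _ => c).
Proof. intros z; exists 0; apply cderiv_const. Qed.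

Lemma holomorphic_id : holomorphic (fun z => z).
Proof. intros z; exists 1; apply cderiv_id. Qed.

Lemma holomorphic_plus (f g : C -> C) :
  holomorphic f -> holomorphic g -> holomorphic (fun z => f z + g z)%C.
Proof.
  intros F G z; destruct (F z) as [l L], (G z) as [m M].
  eexists; apply cderiv_plus; eauto.
Qed.

Lemma holomorphic_minus (f g : C -> C) :
  holomorphic f -> holomorphic g -> holomorphic (fun z => f z - g z)%C.
Proof.
  intros F G z; destruct (F z) as [l L], (G z) as [m M].
  eexists; apply cderiv_minus; eauto.
Qed.

Lemma holomorphic_mult (f g : C -> C) :
  holomorphic f -> holomorphic g -> holomorphic (fun z => f z * g z)%C.
Proof.
  intros F G z; destruct (F z) as [l L], (G z) as [m M].
  eexists; apply cderiv_mult; eauto.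
Qed.

Lemma holomorphic_comp (f g : C -> C) :
  holomorphic f -> holomorphic g -> holomorphic (fun z => f (g z)).
Proof.
  intros F G z; destruct (G z) as [l L], (F (g z)) as [m M].
  eexists; eapply cderiv_comp; eauto.
Qed.

Lemma continuous_Re_line (f : C -> C) (p v : C) (t : R) : holomorphic f ->
  continuous (fun u : R => Re (f (p + u * v)%C)) t.
Proof.
  intros H; destruct (H (p + t * v)%C) as [l L].
  apply (ex_derive_continuous (fun u : R => Re (f (p + u * v)%C))).
  eexists; apply is_derive_Re_line, L.
Qed.

(** * The complex exponential *)

(** Lets statements about imaginary parts be deduced from those about real parts of
    another holomorphic function. *)
Lemma Im_as_Re (w : C) : Im w = Re (- Ci * w)%C.
Proof. destruct w; unfold Re, Im; simpl; ring. Qed.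

Lemma im_le_Cmod (z : C) : Rabs (Im z) <= Cmod z.
Proof.
  rewrite Im_as_Re; apply Rle_trans with (1 := re_le_Cmod _).
  rewrite Cmod_mult, Cmod_opp, Cmod_Ci; lra.
Qed.

Lemma Cmod_le_Re_Im (z : C) : Cmod z <= Rabs (Re z) + Rabs (Im z).
Proof.
  pose proof (Rabs_pos (Re z)); pose proof (Rabs_pos (Im z)).
  apply Rsqr_incr_0_var; [|lra]; rewrite Rsqr_pow2, Cmod2_alt, <- (pow2_abs (Re z)),
    <- (pow2_abs (Im z)); unfold Rsqr; nra.
Qed.

Lemma Re_minus_le (z w : C) : Rabs (Re z - Re w) <= Cmod (z - w)%C.
Proof.
  pose proof (re_le_Cmod (z - w)%C) as H; unfold Cminus in H at 1.
  now rewrite re_plus, re_opp in H.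
Qed.

Lemma Im_minus_le (z w : C) : Rabs (Im z - Im w) <= Cmod (z - w)%C.
Proof.
  pose proof (im_le_Cmod (z - w)%C) as H; unfold Cminus in H at 1.
  now rewrite im_plus, im_opp in H.
Qed.

Definition Cexp (z : C) : C :=
  (exp (Re z) * cos (Im z), exp (Re z) * sin (Im z)).

Lemma Cexp_plus (z w : C) : Cexp (z + w)%C = (Cexp z * Cexp w)%C.
Proof.
  destruct z as [a b], w as [c d]; unfold Cexp, Cmult; simpl.
  rewrite exp_plus, cos_plus, sin_plus; f_equal; ring.
Qed.

Lemma Cexp_RtoC (x : R) : Cexp x = exp x.
Proof. unfold Cexp, RtoC; simpl; rewrite cos_0, sin_0; f_equal; ring. Qed.

Lemma Cexp_0 : Cexp 0 = 1.
Proof. rewrite Cexp_RtoC, exp_0; reflexivity. Qed.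

Lemma Cmod_Cexp (z : C) : Cmod (Cexp z)%C = exp (Re z).
Proof.
  pose proof (exp_pos (Re z)) as P.
  unfold Cmod, Cexp; cbn [fst snd].
  replace ((exp (Re z) * cos (Im z)) ^ 2 + (exp (Re z) * sin (Im z)) ^ 2)
    with (exp (Re z) ^ 2)
    by (pose proof (sin2_cos2 (Im z)) as E; unfold Rsqr in E; nra).
  apply sqrt_pow2; lra.
Qed.

Lemma Cexp_neq_0 (z : C) : Cexp z <> 0.
Proof. apply Cmod_gt_0; rewrite Cmod_Cexp; apply exp_pos. Qed.

Lemma Cexp_opp (z : C) : Cexp (- z)%C = (/ Cexp z)%C.
Proof.
  assert (E : (Cexp z * Cexp (- z))%C = 1).
  { rewrite <- Cexp_plus, Cplus_opp_r; apply Cexp_0. }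
  replace (/ Cexp z)%C with (/ Cexp z * (Cexp z * Cexp (- z)))%C
    by (rewrite E; ring).
  field; apply Cexp_neq_0.
Qed.

Lemma Cexp_period (z : C) (k : nat) :
  Cexp (z + (0%R, (2 * INR k * PI)%R))%C = Cexp z.
Proof.
  destruct z as [x y]; unfold Cexp, Cplus; simpl.
  now rewrite cos_period, sin_period, Rplus_0_r.
Qed.

Lemma exp_near_0 (x : R) : Rabs x <= / 2 -> Rabs (exp x - 1 - x) <= 2 * x ^ 2.
Proof.
  intros Hx; apply Rabs_le_between in Hx.
  pose proof (exp_ineq1_le x) as L; pose proof (exp_ineq1_le (- x)) as U.
  rewrite exp_Ropp in U; pose proof (exp_pos x) as P.
  assert (exp x * (1 + - x) <= 1).
  { apply Rmult_le_compat_l with (r := exp x) in U; [|lra].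
    rewrite Rinv_r in U; lra. }
  apply Rabs_le; nra.
Qed.

Lemma cos_near_0 (y : R) : Rabs (cos y - 1) <= y ^ 2 / 2.
Proof.
  assert (S : Rabs (sin (y / 2)) <= Rabs (y / 2)).
  { destruct (MVT_gen sin 0 (y / 2) cos) as [c [_ E]].
    - intros; apply is_derive_Reals, derivable_pt_lim_sin.
    - intros; apply continuity_sin.
    - rewrite sin_0, !Rminus_0_r in E; rewrite E, Rabs_mult.
      pose proof (Rabs_pos (y / 2)); pose proof (COS_bound c).
      assert (Rabs (cos c) <= 1) by (apply Rabs_le; lra); nra. }
  assert (E : cos y = 1 - 2 * sin (y / 2) * sin (y / 2))
    by (rewrite <- cos_2a_sin; f_equal; field).
  rewrite E; apply Rsqr_le_abs_1 in S; unfold Rsqr in S.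
  apply Rabs_le; nra.
Qed.

Lemma sin_near_0 (y : R) : Rabs y <= / 2 -> Rabs (sin y - y) <= y ^ 2 / 4.
Proof.
  intros Hy.
  destruct (MVT_gen (fun t => sin t - t) 0 y (fun t => cos t - 1)) as [c [Hc E]].
  - intros; auto_derive; auto; ring.
  - intros; apply derivable_continuous; repeat apply derivable_minus;
      [apply derivable_sin|apply derivable_id].
  - rewrite sin_0, !Rminus_0_r in E; rewrite E, Rabs_mult.
    assert (A : Rabs c <= Rabs y).
    { unfold Rmin, Rmax in Hc; destruct (Rle_dec 0 y);
        unfold Rabs; repeat destruct Rcase_abs; lra. }
    pose proof (cos_near_0 c) as K; pose proof (Rabs_pos c).
    rewrite <- (pow2_abs c) in K; rewrite <- (pow2_abs y).
    pose proof (Rabs_pos y); pose proof (Rabs_pos (cos c - 1)).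
    assert (Rabs c ^ 2 <= Rabs y ^ 2) by nra.
    assert (Rabs (cos c - 1) <= Rabs y ^ 2 / 2) by lra.
    assert (Rabs (cos c - 1) <= Rabs y / 4) by nra. nra.
Qed.

(** The quadratic remainder is split into real and imaginary parts, each a combination
    of the one-variable remainders of [exp], [cos] and [sin]. *)
Lemma Cexp_near_0 (h : C) : Cmod h <= / 2 ->
  Cmod (Cexp h - 1 - h)%C <= 4 * Cmod h ^ 2.
Proof.
  intros Hh; pose proof (re_le_Cmod h) as X; pose proof (im_le_Cmod h) as Y.
  rewrite Cmod2_alt.
  pose proof (exp_near_0 (Re h)) as K1; pose proof (cos_near_0 (Im h)) as K2;
  pose proof (sin_near_0 (Im h)) as K3.
  specialize (K1 ltac:(lra)); specialize (K3 ltac:(lra)).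
  apply Rle_trans with (1 := Cmod_le_Re_Im _).
  destruct h as [x y]; cbn [Re Im fst snd Cexp Cminus Cplus Copp RtoC] in *.
  assert (E2 : exp x <= 2).
  { apply Rabs_le_between in K1; apply Rabs_le_between in X; nra. }
  pose proof (exp_pos x) as E0.
  assert (T1 : Rabs (exp x * cos y + - (1) + - x) <= y ^ 2 + 2 * x ^ 2).
  { replace (exp x * cos y + - (1) + - x) with
      (exp x * (cos y - 1) + (exp x - 1 - x)) by ring.
    apply Rle_trans with (1 := Rabs_triang _ _); rewrite Rabs_mult.
    rewrite (Rabs_right (exp x)) by lra.
    pose proof (Rabs_pos (cos y - 1)); nra. }
  assert (T2 : Rabs (exp x * sin y + - 0 + - y) <= y ^ 2 / 2 + (x ^ 2 + y ^ 2)).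
  { replace (exp x * sin y + - 0 + - y) with
      (exp x * (sin y - y) + (exp x - 1) * y) by ring.
    apply Rle_trans with (1 := Rabs_triang _ _); rewrite !Rabs_mult.
    rewrite (Rabs_right (exp x)) by lra.
    pose proof (Rabs_pos (sin y - y)).
    assert (Rabs (exp x - 1) <= 2 * Rabs x).
    { replace (exp x - 1) with ((exp x - 1 - x) + x) by ring.
      apply Rle_trans with (1 := Rabs_triang _ _).
      rewrite <- (pow2_abs x) in K1; pose proof (Rabs_pos x); nra. }
    rewrite <- (pow2_abs x), <- (pow2_abs y) in *.
    pose proof (Rabs_pos x); pose proof (Rabs_pos y).
    assert (Rabs (exp x - 1) * Rabs y <= 2 * Rabs x * Rabs y)
      by (apply Rmult_le_compat_r; auto).
    assert (0 <= (Rabs x - Rabs y) ^ 2) by apply pow2_ge_0. nra. }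
  unfold Re, Im in *; simpl fst in *; simpl snd in *; nra.
Qed.

Lemma cderiv_Cexp (z : C) : cderiv Cexp z (Cexp z)%C.
Proof.
  intros eps Heps; pose proof (exp_pos (Re z)) as P.
  assert (Q : 0 < eps / (4 * exp (Re z))) by (apply Rdiv_lt_0_compat; lra).
  exists (Rmin (/ 2) (eps / (4 * exp (Re z)))); split; [apply Rmin_pos; lra|].
  intros h Hh.
  pose proof (Rmin_l (/ 2) (eps / (4 * exp (Re z))));
  pose proof (Rmin_r (/ 2) (eps / (4 * exp (Re z)))).
  rewrite Cexp_plus.
  replace (Cexp z * Cexp h - Cexp z - Cexp z * h)%C
    with (Cexp z * (Cexp h - 1 - h))%C by ring.
  rewrite Cmod_mult, Cmod_Cexp; pose proof (Cmod_ge_0 h).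
  apply Rle_trans with (exp (Re z) * (4 * Cmod h ^ 2)).
  { apply Rmult_le_compat_l; [lra|]; apply Cexp_near_0; lra. }
  replace (exp (Re z) * (4 * Cmod h ^ 2))
    with (4 * exp (Re z) * Cmod h * Cmod h) by ring.
  apply Rmult_le_compat_r; auto.
  assert (Hd : Cmod h < eps / (4 * exp (Re z))) by lra.
  apply Rlt_div_r in Hd; lra.
Qed.

Lemma holomorphic_Cexp : holomorphic Cexp.
Proof. intros z; eexists; apply cderiv_Cexp. Qed.

Lemma cos_sin_surj (a b : R) : a ^ 2 + b ^ 2 = 1 ->
  exists t, cos t = a /\ sin t = b.
Proof.
  intros E; assert (Ha : -1 <= a <= 1) by nra.
  assert (S : sin (acos a) = Rabs b).
  { rewrite sin_acos by auto.
    replace (1 - a²) with (b²) by (unfold Rsqr; nra); apply sqrt_Rsqr_abs. }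
  destruct (Rle_dec 0 b) as [Hb|Hb].
  - exists (acos a); split; [now apply cos_acos|].
    rewrite S; apply Rabs_right; lra.
  - exists (- acos a); split; [rewrite cos_neg; now apply cos_acos|].
    rewrite sin_neg, S, Rabs_left by lra; ring.
Qed.

Lemma cos_sin_period_Z (t : R) (k : Z) :
  cos (t + 2 * IZR k * PI) = cos t /\ sin (t + 2 * IZR k * PI) = sin t.
Proof.
  destruct (Z_le_gt_dec 0 k) as [H|H].
  - destruct (IZN k) as [m ->]; [lia|]; rewrite <- INR_IZR_INZ.
    now rewrite cos_period, sin_period.
  - destruct (IZN (- k)) as [m E]; [lia|].
    assert (K : IZR k = - INR m) by (rewrite INR_IZR_INZ, <- E, opp_IZR; ring).
    rewrite K, <- (cos_period (t + 2 * - INR m * PI) m),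
      <- (sin_period (t + 2 * - INR m * PI) m).
    split; f_equal; ring.
Qed.

(** A logarithm with imaginary part in any prescribed half-open window of length
    [2 * PI]. The free window matters: the counting argument needs logarithms with a
    huge imaginary part. *)
Lemma Cexp_surj (w : C) (y0 : R) : w <> 0 ->
  exists z, Cexp z = w /\ y0 <= Im z < y0 + 2 * PI.
Proof.
  intros Hw; pose proof (proj1 (Cmod_gt_0 w) Hw) as P.
  destruct (cos_sin_surj (Re w / Cmod w) (Im w / Cmod w)) as [t [Ct St]].
  { replace ((Re w / Cmod w) ^ 2 + (Im w / Cmod w) ^ 2)
      with ((Re w ^ 2 + Im w ^ 2) / Cmod w ^ 2) by (field; lra).
    rewrite <- Cmod2_alt; field; lra. }
  pose proof PI_RGT_0 as Hpi.
  set (q := (y0 - t) / (2 * PI)).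
  destruct (archimed (- q)) as [A1 A2].
  exists (ln (Cmod w), t + 2 * IZR (1 - up (- q)) * PI).
  destruct (cos_sin_period_Z t (1 - up (- q))) as [C1 S1].
  split.
  - unfold Cexp; cbn [Re Im fst snd]; rewrite C1, S1, exp_ln, Ct, St by auto.
    apply injective_projections; cbn [fst snd]; unfold Re, Im; field; lra.
  - cbn [Im snd]; rewrite minus_IZR.
    assert (E : y0 - t = q * (2 * PI)) by (unfold q; field; lra).
    set (u := IZR (up (- q))) in *; clearbody u q.
    assert (0 <= (1 - u - q) * PI < PI) by (split; nra); lra.
Qed.

(** * Goursat's theorem on rectangles *)

(** Compactness of rectangles of fixed proportions, in the form of an induction
    principle: a failure could be pushed into ever smaller quarters, which shrink to a
    point where the local hypothesis contradicts it.
    The local hypothesis concerns only rectangles that contain the point, as Goursat's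
    estimate requires. *)
Lemma rectangle_induction (w h : R) (P : R -> R -> R -> Prop) :
  0 <= w -> 0 <= h ->
  (forall x y t, 0 < t ->
     P x y (t / 2) -> P (x + w * (t / 2)) y (t / 2) ->
     P x (y + h * (t / 2)) (t / 2) ->
     P (x + w * (t / 2)) (y + h * (t / 2)) (t / 2) -> P x y t) ->
  (forall u v, exists d, 0 < d /\ forall x y t, 0 < t < d ->
     x <= u <= x + w * t -> y <= v <= y + h * t -> P x y t) ->
  forall x y t, 0 < t -> P x y t.
Proof.
  intros Hw Hh Hsplit Hloc x y t Ht; apply NNPP; intros N.
  assert (Step : forall q : R * R * R, exists q' : R * R * R,
    let '(a, b, s) := q in let '(a', b', s') := q' in
    0 < s -> ~ P a b s ->
    s' = s / 2 /\ ~ P a' b' s' /\ a <= a' <= a + w * s' /\ b <= b' <= b + h * s').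
  { intros [[a b] s].
    destruct (classic (0 < s /\ ~ P a b s)) as [[Hs Np]|Hn];
      [|exists (a, b, s); tauto].
    assert (0 <= w * (s / 2)) by (apply Rmult_le_pos; lra).
    assert (0 <= h * (s / 2)) by (apply Rmult_le_pos; lra).
    destruct (classic (P a b (s / 2))) as [P1|]; [|exists (a, b, s / 2); intuition lra].
    destruct (classic (P (a + w * (s / 2)) b (s / 2))) as [P2|];
      [|exists (a + w * (s / 2), b, s / 2); intuition lra].
    destruct (classic (P a (b + h * (s / 2)) (s / 2))) as [P3|];
      [|exists (a, b + h * (s / 2), s / 2); intuition lra].
    destruct (classic (P (a + w * (s / 2)) (b + h * (s / 2)) (s / 2))) as [P4|];
      [|exists (a + w * (s / 2), b + h * (s / 2), s / 2); intuition lra].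
    exfalso; apply Np, Hsplit; auto. }
  apply choice in Step; destruct Step as [F HF].
  set (q := fun n => Nat.iter n F (x, y, t)).
  set (X := fun n => fst (fst (q n))); set (Y := fun n => snd (fst (q n)));
  set (S := fun n => snd (q n)).
  assert (Inv : forall n, S n = t / 2 ^ n /\ ~ P (X n) (Y n) (S n)).
  { induction n as [|n [I1 I2]].
    - unfold S, X, Y, q; simpl; split; [field|auto].
    - specialize (HF (q n)); unfold S, X, Y in *.
      change (q (Datatypes.S n)) with (F (q n)).
      destruct (q n) as [[a b] s]; destruct (F (a, b, s)) as [[a' b'] s'].
      cbn [fst snd] in *.
      assert (0 < 2 ^ n) by (apply pow_lt; lra).
      assert (0 < s) by (rewrite I1; apply Rdiv_lt_0_compat; lra).
      destruct HF as [E [H1 _]]; auto; split; auto.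
      rewrite E, I1; simpl; field; lra. }
  assert (Pos : forall n, 0 < S n).
  { intros n; rewrite (proj1 (Inv n)); apply Rdiv_lt_0_compat; auto; apply pow_lt; lra. }
  assert (Mono : forall n, X n <= X (n + 1)%nat /\
     X (n + 1)%nat + w * S (n + 1)%nat <= X n + w * S n /\
     Y n <= Y (n + 1)%nat /\
     Y (n + 1)%nat + h * S (n + 1)%nat <= Y n + h * S n).
  { intros n; rewrite Nat.add_1_r; pose proof (HF (q n)) as G.
    pose proof (Inv n) as [_ I2]; pose proof (Pos n) as I3.
    unfold S, X, Y in *; change (q (Datatypes.S n)) with (F (q n)).
    destruct (q n) as [[a b] s]; destruct (F (a, b, s)) as [[a' b'] s'].
    cbn [fst snd] in *.
    destruct G as [E [_ [G1 G2]]]; auto; subst s'; repeat split; nra. }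
  assert (Nest : forall n m,
     X n <= X (n + m)%nat /\ X (n + m)%nat + w * S (n + m)%nat <= X n + w * S n /\
     Y n <= Y (n + m)%nat /\ Y (n + m)%nat + h * S (n + m)%nat <= Y n + h * S n).
  { intros n; induction m as [|m IH].
    - rewrite Nat.add_0_r; lra.
    - pose proof (Mono (n + m)%nat) as M.
      replace (n + m + 1)%nat with (n + Datatypes.S m)%nat in M by lia; lra. }
  assert (NestX : forall n m, X m <= X n + w * S n /\ Y m <= Y n + h * S n).
  { intros n m; destruct (Nest n m) as [_ [A1 [_ A2]]];
    destruct (Nest m n) as [B1 [_ [B2 _]]].
    rewrite (Nat.add_comm m n) in *; pose proof (Pos (n + m)%nat); nra. }
  destruct (completeness (fun r => exists n, r = X n)) as [u [U1 U2]].
  { exists (X 0%nat + w * S 0%nat); intros r [n ->]; apply NestX. }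
  { now exists (X 0%nat), 0%nat. }
  destruct (completeness (fun r => exists n, r = Y n)) as [v [V1 V2]].
  { exists (Y 0%nat + h * S 0%nat); intros r [n ->]; apply NestX. }
  { now exists (Y 0%nat), 0%nat. }
  destruct (Hloc u v) as [d [Hd K]].
  destruct (pow_lt_1_zero (/ 2)) with (y := d / t) as [n Hn];
    [rewrite Rabs_right; lra|apply Rdiv_lt_0_compat; auto|].
  specialize (Hn n (Nat.le_refl n)).
  rewrite Rabs_right in Hn by (apply Rle_ge, pow_le; lra).
  destruct (Inv n) as [I1 I2]; apply I2, K.
  - split; auto; rewrite I1.
    apply Rlt_div_r in Hn; auto; unfold Rdiv; rewrite <- pow_inv; lra.
  - split; [apply U1; now exists n|apply U2; intros r [m ->]; apply NestX].
  - split; [apply V1; now exists n|apply V2; intros r [m ->]; apply NestX].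
Qed.

Lemma bounded_on_discs (f : C -> C) (rho : R) : holomorphic f ->
  exists B, 0 < B /\ forall z, Cmod z <= rho -> Cmod (f z)%C <= B.
Proof.
  intros Hf; destruct (Rle_lt_dec rho 0) as [Hr|Hr].
  { exists (Cmod (f 0)%C + 1); split; [pose proof (Cmod_ge_0 (f 0)); lra|].
    intros z Hz; pose proof (Cmod_ge_0 z).
    rewrite (Cmod_eq_0 z) by lra; lra. }
  destruct (rectangle_induction 2 2 (fun x y t => exists B, forall u v,
    x <= u <= x + 2 * t -> y <= v <= y + 2 * t -> Cmod (f (u, v))%C <= B))
    with (x := - rho) (y := - rho) (t := rho) as [B HB]; try lra.
  - intros x y t Ht [B1 H1] [B2 H2] [B3 H3] [B4 H4].
    exists (Rmax (Rmax B1 B2) (Rmax B3 B4)); intros u v Hu Hv.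
    pose proof (Rmax_l (Rmax B1 B2) (Rmax B3 B4));
    pose proof (Rmax_r (Rmax B1 B2) (Rmax B3 B4));
    pose proof (Rmax_l B1 B2); pose proof (Rmax_r B1 B2);
    pose proof (Rmax_l B3 B4); pose proof (Rmax_r B3 B4).
    destruct (Rle_lt_dec u (x + t)), (Rle_lt_dec v (y + t));
    [specialize (H1 u v)|specialize (H3 u v)|specialize (H2 u v)|specialize (H4 u v)];
    lra.
  - intros u0 v0; destruct (Hf (u0, v0)) as [l Hl].
    destruct (cderiv_continuous f (u0, v0) _ Hl 1 Rlt_0_1)
      as [d [Hd K]].
    exists (d / 8); split; [lra|]; intros x y t Ht Hx Hy.
    exists (Cmod (f (u0, v0))%C + 1); intros u v Hu Hv.
    specialize (K ((u, v) - (u0, v0))%C).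
    rewrite Cplus_minus in K.
    pose proof (Cmod_le_add_sub (f (u, v))%C (f (u0, v0))%C).
    assert (Cmod ((u, v) - (u0, v0))%C < d); [|lra].
    apply Rle_lt_trans with (1 := Cmod_le_Re_Im _); unfold Re, Im; simpl.
    assert (Rabs (u + - u0) <= 2 * t) by (apply Rabs_le; lra).
    assert (Rabs (v + - v0) <= 2 * t) by (apply Rabs_le; lra). lra.
  - exists (Rabs B + 1); split; [pose proof (Rabs_pos B); lra|]; intros z Hz.
    pose proof (re_le_Cmod z) as X; pose proof (im_le_Cmod z) as Y.
    apply Rabs_le_between in X; apply Rabs_le_between in Y.
    rewrite (surjective_pairing z); apply Rle_trans with B;
      [|pose proof (Rle_abs B); lra].
    unfold Re, Im in *; apply HB; lra.
Qed.

Lemma RInt_Rplus (f g : R -> R) (a b : R) : ex_RInt f a b -> ex_RInt g a b ->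
  RInt (fun t => f t + g t) a b = RInt f a b + RInt g a b.
Proof. exact (RInt_plus (V := R_CompleteNormedModule) f g a b). Qed.

(** The integration rules below restate general ones at real-valued functions with the
    operations of [R] displayed, so that [rewrite] and [ring] see them. *)
Lemma RInt_Rext (f g : R -> R) (a b : R) : (forall t, f t = g t) ->
  RInt f a b = RInt g a b.
Proof. intros E; apply RInt_ext; intros; apply E. Qed.

Lemma RInt_RChasles (f : R -> R) (a b c : R) : ex_RInt f a b -> ex_RInt f b c ->
  RInt f a c = RInt f a b + RInt f b c.
Proof. intros; symmetry; now apply (RInt_Chasles (V := R_CompleteNormedModule)). Qed.

Lemma RInt_near_const (f : R -> R) (a b c m : R) : a <= b -> ex_RInt f a b ->
  (forall t, a <= t <= b -> Rabs (f t - c) <= m) ->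
  Rabs (RInt f a b - (b - a) * c) <= (b - a) * m.
Proof.
  intros Hab Hf Hm.
  assert (Hc : ex_RInt (fun _ => - c) a b) by apply ex_RInt_const.
  replace (RInt f a b - (b - a) * c) with (RInt (fun t => f t + - c) a b).
  - apply abs_RInt_le_const; auto; now apply (ex_RInt_plus (V := R_NormedModule)).
  - rewrite RInt_Rplus, RInt_const; auto; unfold scal; simpl; unfold mult; simpl; ring.
Qed.

Section Goursat.
Variable G : C -> C.
Hypothesis HG : holomorphic G.

Lemma continuous_Re_horizontal (y u : R) : continuous (fun x : R => Re (G (x, y))) u.
Proof.
  apply continuous_ext with (fun x : R => Re (G ((0, y) + x * 1))%C).
  { intros x; do 2 f_equal; apply injective_projections; simpl; ring. }
  apply continuous_Re_line, HG.
Qed.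

Lemma continuous_Im_vertical (x v : R) : continuous (fun y : R => Im (G (x, y))) v.
Proof.
  apply continuous_ext with (fun y : R => Re (- Ci * G ((x, 0) + y * Ci))%C).
  { intros y; rewrite Im_as_Re; do 3 f_equal.
    apply injective_projections; simpl; ring. }
  apply (continuous_Re_line (fun z => - Ci * G z)%C).
  apply holomorphic_mult; auto using holomorphic_const.
Qed.

(** The real part of the contour integral of [G] around the rectangle
    [[x1, x2] x [y1, y2]]. Opposite sides are paired inside one integral so that
    both integrands are constant when [G] is affine and the two integrals cancel. *)
Definition circulation (x1 x2 y1 y2 : R) : R :=
  RInt (fun u => Re (G (u, y1)) - Re (G (u, y2))) x1 x2 -
  RInt (fun v => Im (G (x2, v)) - Im (G (x1, v))) y1 y2.

Lemma ex_RInt_horizontal (y1 y2 a b : R) :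
  ex_RInt (fun u => Re (G (u, y1)) - Re (G (u, y2))) a b.
Proof.
  apply (ex_RInt_continuous (V := R_CompleteNormedModule)); intros u _.
  apply (continuous_minus (V := R_NormedModule)); apply continuous_Re_horizontal.
Qed.

Lemma ex_RInt_vertical (x1 x2 a b : R) :
  ex_RInt (fun v => Im (G (x2, v)) - Im (G (x1, v))) a b.
Proof.
  apply (ex_RInt_continuous (V := R_CompleteNormedModule)); intros u _.
  apply (continuous_minus (V := R_NormedModule)); apply continuous_Im_vertical.
Qed.

Lemma circulation_split_x (x1 x2 x3 y1 y2 : R) :
  circulation x1 x3 y1 y2 = circulation x1 x2 y1 y2 + circulation x2 x3 y1 y2.
Proof.
  unfold circulation.
  rewrite (RInt_RChasles _ x1 x2 x3) by apply ex_RInt_horizontal.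
  rewrite (RInt_Rext (fun v => Im (G (x3, v)) - Im (G (x1, v)))
    (fun v => (Im (G (x2, v)) - Im (G (x1, v))) + (Im (G (x3, v)) - Im (G (x2, v)))))
    by (intros; ring).
  rewrite RInt_Rplus by apply ex_RInt_vertical; ring.
Qed.

Lemma circulation_split_y (x1 x2 y1 y2 y3 : R) :
  circulation x1 x2 y1 y3 = circulation x1 x2 y1 y2 + circulation x1 x2 y2 y3.
Proof.
  unfold circulation.
  rewrite (RInt_RChasles _ y1 y2 y3) by apply ex_RInt_vertical.
  rewrite (RInt_Rext (fun u => Re (G (u, y1)) - Re (G (u, y3)))
    (fun u => (Re (G (u, y1)) - Re (G (u, y2))) + (Re (G (u, y2)) - Re (G (u, y3)))))
    by (intros; ring).
  rewrite RInt_Rplus by apply ex_RInt_horizontal; ring.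
Qed.

(** Near a point the function is affine up to an error [eps] times the distance, and the
    affine part contributes nothing, so the circulation is [eps] times the square of
    the perimeter. *)
Lemma circulation_small (u v eps : R) : 0 < eps ->
  exists d, 0 < d /\ forall x1 x2 y1 y2,
    x1 <= u <= x2 -> y1 <= v <= y2 -> (x2 - x1) + (y2 - y1) < d ->
    Rabs (circulation x1 x2 y1 y2) <= 2 * eps * ((x2 - x1) + (y2 - y1)) ^ 2.
Proof.
  intros Heps; destruct (HG (u, v)) as [l Hl].
  destruct (Hl eps Heps) as [d [Hd K]].
  exists d; split; auto; intros x1 x2 y1 y2 Hu Hv Hs.
  set (p := (u, v) : C) in *.
  set (D := (x2 - x1) + (y2 - y1)) in *.
  assert (Err : forall a b, x1 <= a <= x2 -> y1 <= b <= y2 ->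
     Cmod (G (a, b) - G p - l * ((a, b) - p))%C <= eps * D).
  { intros a b Ha Hb.
    assert (Q : Cmod ((a, b) - p)%C <= D).
    { apply Rle_trans with (1 := Cmod_le_Re_Im _); unfold p, Re, Im, D; simpl.
      assert (Rabs (a + - u) <= x2 - x1) by (apply Rabs_le; lra).
      assert (Rabs (b + - v) <= y2 - y1) by (apply Rabs_le; lra). lra. }
    specialize (K ((a, b) - p)%C);
    rewrite Cplus_minus in K.
    apply Rle_trans with (eps * Cmod ((a, b) - p)%C); [apply K; lra|].
    apply Rmult_le_compat_l; lra. }
  assert (H1 := RInt_near_const (fun t => Re (G (t, y1)) - Re (G (t, y2))) x1 x2
    (Im l * (y2 - y1)) (2 * (eps * D)) ltac:(lra) (ex_RInt_horizontal _ _ _ _)).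
  assert (H2 := RInt_near_const (fun t => Im (G (x2, t)) - Im (G (x1, t))) y1 y2
    (Im l * (x2 - x1)) (2 * (eps * D)) ltac:(lra) (ex_RInt_vertical _ _ _ _)).
  unfold circulation.
  assert (Q1 := H1 ltac:(clear H1 H2; intros t Ht;
    pose proof (Err t y1 ltac:(lra) ltac:(lra)) as E1;
    pose proof (Err t y2 ltac:(lra) ltac:(lra)) as E2;
    pose proof (re_le_Cmod (G (t, y1) - G p - l * ((t, y1) - p))%C) as R1;
    pose proof (re_le_Cmod (G (t, y2) - G p - l * ((t, y2) - p))%C) as R2;
    apply (Rle_trans _ _ _ R1) in E1; apply (Rle_trans _ _ _ R2) in E2;
    apply Rabs_le_between in E1; apply Rabs_le_between in E2;
    unfold p, Re, Im in *; simpl in E1, E2; apply Rabs_le; lra)).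
  assert (Q2 := H2 ltac:(clear H1 H2 Q1; intros t Ht;
    pose proof (Err x1 t ltac:(lra) ltac:(lra)) as E1;
    pose proof (Err x2 t ltac:(lra) ltac:(lra)) as E2;
    pose proof (im_le_Cmod (G (x1, t) - G p - l * ((x1, t) - p))%C) as R1;
    pose proof (im_le_Cmod (G (x2, t) - G p - l * ((x2, t) - p))%C) as R2;
    apply (Rle_trans _ _ _ R1) in E1; apply (Rle_trans _ _ _ R2) in E2;
    apply Rabs_le_between in E1; apply Rabs_le_between in E2;
    unfold p, Re, Im in *; simpl in E1, E2; apply Rabs_le; lra)).
  apply Rabs_le_between in Q1; apply Rabs_le_between in Q2.
  apply Rabs_le.
  replace (2 * eps * D ^ 2) with ((x2 - x1) * (2 * (eps * D)) + (y2 - y1) * (2 * (eps * D)))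
    by (unfold D; ring).
  lra.
Qed.

(** The bound of [circulation_small] scales like the area, hence is reproduced exactly by
    quartering; [rectangle_induction] carries it from small rectangles to all of them,
    and [eps] is arbitrary. *)
Lemma goursat (x1 x2 y1 y2 : R) : x1 <= x2 -> y1 <= y2 -> circulation x1 x2 y1 y2 = 0.
Proof.
  intros Hx Hy; set (w := x2 - x1); set (h := y2 - y1).
  assert (B : forall eps, 0 < eps ->
    Rabs (circulation x1 x2 y1 y2) <= 2 * eps * (w + h) ^ 2).
  { intros eps Heps.
    assert (Q : forall x y t, 0 < t ->
      Rabs (circulation x (x + w * t) y (y + h * t)) <= 2 * eps * (w + h) ^ 2 * t ^ 2).
    2:{ specialize (Q x1 y1 1 Rlt_0_1).
        replace (x1 + w * 1) with x2 in Q by (unfold w; ring).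
        replace (y1 + h * 1) with y2 in Q by (unfold h; ring); lra. }
    apply (rectangle_induction w h (fun x y t =>
      Rabs (circulation x (x + w * t) y (y + h * t)) <= 2 * eps * (w + h) ^ 2 * t ^ 2));
      [unfold w; lra|unfold h; lra| |].
    - intros x y t Ht K1 K2 K3 K4.
      rewrite (circulation_split_x x (x + w * (t / 2))),
        (circulation_split_y x _ y (y + h * (t / 2))),
        (circulation_split_y (x + w * (t / 2)) _ y (y + h * (t / 2))).
      replace (x + w * (t / 2) + w * (t / 2)) with (x + w * t) in * by field.
      replace (y + h * (t / 2) + h * (t / 2)) with (y + h * t) in * by field.
      apply Rabs_le_between in K1; apply Rabs_le_between in K2;
      apply Rabs_le_between in K3; apply Rabs_le_between in K4.
      replace (2 * eps * (w + h) ^ 2 * t ^ 2)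
        with (4 * (2 * eps * (w + h) ^ 2 * (t / 2) ^ 2))
        by field.
      apply Rabs_le; lra.
    - intros u v; destruct (circulation_small u v eps Heps) as [d [Hd K]].
      assert (W : 0 <= w + h) by (unfold w, h; lra).
      exists (d / (w + h + 1)); split; [apply Rdiv_lt_0_compat; lra|].
      intros x y t [Ht1 Ht2] Hu Hv.
      replace (2 * eps * (w + h) ^ 2 * t ^ 2)
        with (2 * eps * ((x + w * t - x) + (y + h * t - y)) ^ 2) by ring.
      apply K; auto; apply Rlt_div_r in Ht2; nra. }
  apply NNPP; intros N; apply Rabs_pos_lt in N.
  set (A := Rabs (circulation x1 x2 y1 y2)) in *.
  assert (0 <= (w + h) ^ 2) by apply pow2_ge_0.
  specialize (B (A / (4 * ((w + h) ^ 2 + 1))) ltac:(apply Rdiv_lt_0_compat; lra)).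
  apply (Rlt_irrefl A); apply Rle_lt_trans with (1 := B).
  replace (2 * (A / (4 * ((w + h) ^ 2 + 1))) * (w + h) ^ 2)
    with (A * (2 * (w + h) ^ 2) / (4 * ((w + h) ^ 2 + 1))) by (field; lra).
  apply Rlt_div_l; nra.
Qed.

End Goursat.

(** * Circle means and the Borel-Caratheodory estimate *)

Lemma ex_RInt_Re_vertical (G : C -> C) (x a b : R) : holomorphic G ->
  ex_RInt (fun v => Re (G (x, v))%C) a b.
Proof.
  intros HG; apply (ex_RInt_continuous (V := R_CompleteNormedModule)); intros v _.
  apply continuous_ext with (fun y : R => Re (G ((x, 0%R) + y * Ci)%C)%C).
  { intros y; do 2 f_equal; apply injective_projections; simpl; ring. }
  now apply continuous_Re_line.
Qed.

(** For a function of period [2 * PI * Ci] the horizontal sides of the rectangle cancel.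
    With [G s = H (Cexp s)] this says that circle means of [H] do not depend on
    the radius, and no derivative under an integral sign is involved. *)
Lemma circle_mean_const (G : C -> C) (x1 x2 : R) : holomorphic G ->
  (forall x, G (x, 2 * PI) = G (x, 0)) -> x1 <= x2 ->
  RInt (fun v => Re (G (x1, v))%C) 0 (2 * PI) = RInt (fun v => Re (G (x2, v))%C) 0 (2 * PI).
Proof.
  intros HG Hper Hx; pose proof PI_RGT_0.
  assert (HiG : holomorphic (fun z => Ci * G z)%C)
    by (apply holomorphic_mult; auto using holomorphic_const).
  pose proof (goursat _ HiG x1 x2 0 (2 * PI) Hx ltac:(lra)) as E; unfold circulation in E.
  rewrite (RInt_Rext (fun u => _ - _) (fun _ => 0)) in E
    by (intros; rewrite Hper; ring).
  rewrite RInt_const in E.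
  rewrite (RInt_Rext _ (fun v => Re (G (x2, v))%C + - 1 * Re (G (x1, v))%C)) in E.
  2:{ intros v; destruct (G (x2, v)), (G (x1, v)); unfold Re, Im; simpl; ring. }
  rewrite RInt_Rplus in E.
  - rewrite (RInt_scal (V := R_CompleteNormedModule)) in E
      by (now apply ex_RInt_Re_vertical).
    unfold scal in E; simpl in E; unfold mult in E; simpl in E; lra.
  - now apply ex_RInt_Re_vertical.
  - apply (ex_RInt_scal (V := R_NormedModule)); now apply ex_RInt_Re_vertical.
Qed.

(** Letting the radius [exp x] tend to [0] identifies the common mean with [2 * PI * L]. *)
Lemma circle_mean_limit (G : C -> C) (L : C) (m x : R) : holomorphic G ->
  (forall x, G (x, 2 * PI) = G (x, 0)) ->
  (forall eps, 0 < eps -> exists x0, forall s, Re s <= x0 -> Cmod (G s - L)%C <= eps) ->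
  (forall v, m <= Re (G (x, v))%C) -> m <= Re L.
Proof.
  intros HG Hper Hlim Hm; pose proof PI_RGT_0.
  apply Rnot_lt_le; intros N.
  destruct (Hlim ((m - Re L) / 2)) as [x0 K]; [lra|].
  assert (A : RInt (fun v => Re (G (Rmin x x0, v))%C) 0 (2 * PI)
              <= (2 * PI - 0) * (Re L + (m - Re L) / 2)).
  { rewrite <- (RInt_const (V := R_CompleteNormedModule)).
    apply RInt_le; [lra|now apply ex_RInt_Re_vertical|apply ex_RInt_const|].
    intros v _; specialize (K (Rmin x x0, v) (Rmin_r _ _)).
    pose proof (re_le_Cmod (G (Rmin x x0, v) - L)%C) as R1.
    apply (Rle_trans _ _ _ R1) in K; apply Rabs_le_between in K.
    unfold Cminus in K; rewrite re_plus, re_opp in K; lra. }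
  assert (B : (2 * PI - 0) * m <= RInt (fun v => Re (G (x, v))%C) 0 (2 * PI)).
  { rewrite <- (RInt_const (V := R_CompleteNormedModule)).
    apply RInt_le; [lra|apply ex_RInt_const|now apply ex_RInt_Re_vertical|auto]. }
  rewrite <- (circle_mean_const G (Rmin x x0) x) in B; auto using Rmin_l.
  nra.
Qed.

Lemma Cexp_2PI (x : R) : Cexp (x, (2 * PI)%R) = Cexp (x, 0%R).
Proof. unfold Cexp; cbn [Re Im fst snd]; now rewrite cos_2PI, sin_2PI, cos_0, sin_0. Qed.

(** The modulus as the value of a real-linear functional: this turns bounds on moduli
    into bounds on real parts. *)
Lemma Cmod_exists_phase (w : C) : exists c, Cmod c = 1 /\ (c * w)%C = - Cmod w.
Proof.
  destruct (Ceq_dec w 0) as [->|Hw].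
  - exists 1; rewrite Cmod_1, Cmod_0, Cmult_0_r; split; auto.
    apply injective_projections; simpl; ring.
  - pose proof (proj1 (Cmod_gt_0 w) Hw).
    assert (Hm : RtoC (Cmod w) <> 0) by (intros E; apply RtoC_inj in E; lra).
    exists (- (RtoC (Cmod w) / w))%C; split.
    + rewrite Cmod_opp, Cmod_div, Cmod_R, Rabs_right by (auto; lra); field; lra.
    + rewrite ?RtoC_opp; field; auto.
Qed.

(** A one-sided bound on the real part controls the derivative. On the circle of radius
    [T] about [p] write [z = p + T e^(iv)]; then the real part of
    [h z - h p], multiplied by the factor [2 * Re (c * e^(-iv)) - 2], which lies
    between [-4] and [0], is at least [-4 * (M - Re (h p))]. The mean of this product
    over the circle is [Re (T * c * l)], since the other two Fourier coefficients that
    enter vanish.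
    The factor [M - Re (h p)] on the right, rather than a bound for [h], is what makes
    the estimate strong when [h p] is nearly extremal. *)
Lemma borel_caratheodory (h : C -> C) (p l : C) (M T : R) : holomorphic h ->
  cderiv h p l -> 0 < T -> (forall z, Cmod (z - p)%C <= T -> Re (h z)%C <= M) ->
  Cmod l <= 4 * (M - Re (h p)%C) / T.
Proof.
  intros Hh Hl HT HM; destruct (Cmod_exists_phase l) as [c [Hc Ec]].
  assert (HT' : RtoC T <> 0) by (intros E; apply RtoC_inj in E; lra).
  (* On the circle [Re s = ln T] this factor is real. *)
  pose (k := fun s => (T * c * Cexp (- s) + Cconj c / T * Cexp s - 2)%C).
  pose (G := fun s => (k s * (h (p + Cexp s) - h p))%C).
  assert (HG : holomorphic G).
  { unfold G, k; apply holomorphic_mult.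
    - apply holomorphic_minus; [apply holomorphic_plus|]; try apply holomorphic_const;
        (apply holomorphic_mult; [apply holomorphic_const|]); [|apply holomorphic_Cexp].
      apply (holomorphic_comp Cexp (fun s => - s)%C); [apply holomorphic_Cexp|].
      intros z; exists (0 - 1)%C; apply (cderiv_ext (fun w => 0 - w)%C); [intros; ring|].
      apply cderiv_minus; [apply cderiv_const|apply cderiv_id].
    - apply holomorphic_minus; [|apply holomorphic_const].
      apply (holomorphic_comp h (fun s => p + Cexp s)%C); auto.
      apply holomorphic_plus; [apply holomorphic_const|apply holomorphic_Cexp]. }
  assert (M0 : 0 <= M - Re (h p)%C).
  { specialize (HM p); replace (p - p)%C with (RtoC 0) in HM by ring.
    rewrite Cmod_0 in HM; lra. }
  assert (Key : -4 * (M - Re (h p)%C) <= Re (T * c * l)%C).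
  { apply (circle_mean_limit G _ _ (ln T)); auto.
    - intros x; unfold G, k; rewrite !Cexp_opp, !Cexp_2PI; reflexivity.
    - intros eps Heps; pose proof (Cmod_ge_0 l) as L0.
      (* As the radius shrinks, [h (p + e) - h p] is [l * e] up to [o(e)], so the product
         with [T * c / e] tends to [T * c * l] and the two remaining terms vanish. *)
      set (e1 := eps / (2 * T)).
      assert (He1 : 0 < e1) by (apply Rdiv_lt_0_compat; lra).
      destruct (Hl e1 He1) as [d [Hd K]].
      set (r := Rmin (d / 2) (Rmin T (eps / (6 * (Cmod l + e1))))).
      assert (Hr : 0 < r).
      { repeat apply Rmin_pos; try lra; apply Rdiv_lt_0_compat; lra. }
      exists (ln r); intros s Hs.
      assert (Rs : Cmod (Cexp s) <= r).
      { rewrite Cmod_Cexp, <- (exp_ln r) by auto.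
        destruct Hs as [Hs| ->]; [apply Rlt_le, exp_increasing, Hs|lra]. }
      pose proof (Rmin_l (d / 2) (Rmin T (eps / (6 * (Cmod l + e1))))) as R1.
      pose proof (Rmin_r (d / 2) (Rmin T (eps / (6 * (Cmod l + e1))))) as R2.
      pose proof (Rmin_l T (eps / (6 * (Cmod l + e1)))) as R3.
      pose proof (Rmin_r T (eps / (6 * (Cmod l + e1)))) as R4.
      fold r in R1, R2.
      specialize (K (Cexp s) ltac:(lra)).
      unfold G, k; rewrite Cexp_opp.
      pose proof (Cexp_neq_0 s) as Ne; set (e := Cexp s) in *.
      set (D := (h (p + e) - h p)%C) in *.
      pose proof (proj1 (Cmod_gt_0 e) Ne) as e0.
      replace ((T * c * / e + Cconj c / T * e - 2) * D - T * c * l)%C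
        with (T * c / e * (D - l * e) + (Cconj c / T * e - 2) * D)%C by (field; auto).
      apply Rle_trans with (1 := Cmod_triangle _ _).
      rewrite !Cmod_mult.
      assert (A1 : Cmod (T * c / e)%C * Cmod (D - l * e)%C <= eps / 2).
      { rewrite Cmod_div, Cmod_mult, Hc, Cmod_R, Rabs_right by (auto; lra).
        apply Rle_trans with (T * 1 / Cmod e * (e1 * Cmod e)).
        - apply Rmult_le_compat_l; auto; apply Rlt_le, Rdiv_lt_0_compat; lra.
        - apply Req_le; unfold e1; field; lra. }
      assert (A2 : Cmod D <= (Cmod l + e1) * Cmod e).
      { pose proof (Cmod_le_add_sub D (l * e)%C) as Q; rewrite Cmod_mult in Q; lra. }
      assert (A3 : Cmod (Cconj c / T * e - 2)%C <= 3).
      { apply Rle_trans with (1 := Cmod_triangle _ _).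
        rewrite Cmod_opp, Cmod_mult, Cmod_div, Cmod_conj, Hc, !Cmod_R, !Rabs_right
          by (auto; lra).
        enough (1 / T * Cmod e <= 1) by lra.
        replace (1 / T * Cmod e) with (Cmod e / T) by (field; lra).
        apply Rle_div_l; lra. }
      assert (A4 : (Cmod l + e1) * Cmod e <= eps / 6).
      { apply Rle_trans with ((Cmod l + e1) * (eps / (6 * (Cmod l + e1)))).
        - apply Rmult_le_compat_l; lra.
        - apply Req_le; field; lra. }
      pose proof (Cmod_ge_0 D); pose proof (Cmod_ge_0 (Cconj c / T * e - 2)%C); nra.
    - intros v; set (s := (ln T, v) : C).
      assert (E1 : Cexp s = (T * Cexp (0%R, v)%C)%C).
      { unfold s, Cexp; cbn [Re Im fst snd]; rewrite exp_ln, exp_0 by auto.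
        apply injective_projections; simpl; ring. }
      assert (E2 : k s = RtoC (2 * Re (c * Cconj (Cexp (0%R, v)%C))%C - 2)).
      { unfold k; rewrite Cexp_opp, E1.
        assert (E3 : (Cexp (0%R, v)%C * Cconj (Cexp (0%R, v)%C))%C = 1).
        { rewrite <- Cmod2_conj, Cmod_Cexp; simpl; rewrite exp_0; f_equal; ring. }
        assert (N : Cexp (0%R, v)%C <> 0) by apply Cexp_neq_0.
        set (e := Cexp (0%R, v)%C) in *.
        replace (/ (T * e))%C with (/ T * Cconj e)%C.
        2:{ replace (Cconj e) with (/ e * (e * Cconj e))%C by (field; auto).
            rewrite E3; field; auto. }
        replace (T * c * (/ T * Cconj e) + Cconj c / T * (T * e) - 2)%C
          with (c * Cconj e + Cconj c * e - 2)%C by (field; auto).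
        destruct c, e; apply injective_projections; simpl; ring. }
      unfold G; rewrite E2, re_scal_l.
      assert (B1 : Rabs (Re (c * Cconj (Cexp (0%R, v)%C))%C) <= 1).
      { apply Rle_trans with (1 := re_le_Cmod _).
        rewrite Cmod_mult, Cmod_conj, Cmod_Cexp, Hc; simpl; rewrite exp_0; lra. }
      apply Rabs_le_between in B1.
      assert (B2 : Re (h (p + Cexp s) - h p)%C <= M - Re (h p)%C).
      { unfold Cminus; rewrite re_plus, re_opp.
        enough (Re (h (p + Cexp s))%C <= M) by lra.
        apply HM; replace (p + Cexp s - p)%C with (Cexp s) by ring.
        rewrite Cmod_Cexp; simpl; rewrite exp_ln; lra. }
      nra. }
  replace (T * c * l)%C with (T * (c * l))%C in Key by ring.
  rewrite Ec, re_scal_l in Key.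
  rewrite re_RtoC in Key; apply Rle_div_r; lra.
Qed.

(** * Cauchy's estimate and the holomorphy of derivatives *)

Lemma cauchy_estimate (h : C -> C) (p l : C) (B T : R) : holomorphic h ->
  cderiv h p l -> 0 < T -> (forall z, Cmod (z - p)%C <= T -> Cmod (h z)%C <= B) ->
  Cmod l <= 8 * B / T.
Proof.
  intros Hh Hl HT HB.
  assert (Hp : Cmod (h p)%C <= B).
  { apply HB; replace (p - p)%C with (RtoC 0) by ring; rewrite Cmod_0; lra. }
  apply Rle_trans with (4 * (B - Re (h p)%C) / T).
  - apply (borel_caratheodory h); auto; intros z Hz; specialize (HB z Hz).
    pose proof (re_le_Cmod (h z)%C) as K; apply Rabs_le_between in K; lra.
  - pose proof (re_le_Cmod (h p)%C) as K; apply Rabs_le_between in K.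
    apply Rmult_le_compat_r; [apply Rlt_le, Rinv_0_lt_compat; auto|lra].
Qed.

Lemma Cmod_le_of_unit_functionals (w : C) (K : R) :
  (forall c, Cmod c = 1 -> - Re (c * w)%C <= K) -> Cmod w <= K.
Proof.
  intros H; destruct (Cmod_exists_phase w) as [c [Hc E]].
  specialize (H c Hc); rewrite E, re_RtoC in H; lra.
Qed.

(** The real mean value theorem applied to [Re (c * f)] along the segment, with [c]
    the phase that turns [f b - f a] into minus its modulus. *)
Lemma mean_value_inequality (f f' : C -> C) (a b : C) (K : R) :
  (forall z, cderiv f z (f' z)) ->
  (forall t : R, 0 <= t <= 1 -> Cmod (f' (a + t * (b - a)))%C <= K) ->
  Cmod (f b - f a)%C <= K * Cmod (b - a)%C.
Proof.
  intros Hf HK; apply Cmod_le_of_unit_functionals; intros c Hc.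
  set (phi := fun t : R => Re (c * f (a + t * (b - a)))%C).
  destruct (MVT_gen phi 0 1 (fun t => Re (c * f' (a + t * (b - a)) * (b - a))%C))
    as [t [Ht E]].
  - intros t _; apply (is_derive_Re_line (fun z => c * f z)%C), cderiv_scal, Hf.
  - intros t _; apply continuity_pt_filterlim.
    apply (continuous_Re_line (fun z => c * f z)%C).
    intros z; eexists; apply cderiv_scal, Hf.
  - rewrite Rmin_left, Rmax_right in Ht by lra.
    replace (- Re (c * (f b - f a))%C) with (- (phi 1 - phi 0)).
    2:{ unfold phi; replace (a + 1 * (b - a))%C with b by ring.
        replace (a + 0 * (b - a))%C with a by ring.
        rewrite !re_mult; unfold Cminus; rewrite re_plus, im_plus, re_opp, im_opp; ring. }
    rewrite E, Rminus_0_r, Rmult_1_r.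
    apply Rle_trans with (1 := Rle_abs _); rewrite Rabs_Ropp.
    apply Rle_trans with (1 := re_le_Cmod _).
    rewrite !Cmod_mult, Hc, Rmult_1_l.
    apply Rmult_le_compat_r; [apply Cmod_ge_0|auto].
Qed.

Lemma Cmod_segment (a b : C) (rho t : R) : Cmod a <= rho -> Cmod b <= rho ->
  0 <= t <= 1 -> Cmod (a + t * (b - a))%C <= rho.
Proof.
  intros Ha Hb Ht; replace (a + t * (b - a))%C with ((1 - t)%R * a + t * b)%C
    by (rewrite RtoC_minus; ring).
  apply Rle_trans with (1 := Cmod_triangle _ _).
  rewrite !Cmod_mult, !Cmod_R, !Rabs_right by lra; nra.
Qed.

Lemma holomorphic_shift (f : C -> C) (w : C) :
  holomorphic f -> holomorphic (fun z => f (z + w)%C).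
Proof.
  intros Hf; apply (holomorphic_comp f (fun z => z + w)%C); auto.
  apply holomorphic_plus; auto using holomorphic_id, holomorphic_const.
Qed.

Lemma cderiv_shift (f : C -> C) (w z l : C) :
  cderiv f (z + w) l -> cderiv (fun z => f (z + w)%C) z l.
Proof.
  intros H; apply (cderiv_eq _ _ (l * (1 + 0))%C); [ring|].
  apply (cderiv_comp f (fun z => z + w)%C); auto.
  apply cderiv_plus; [apply cderiv_id|apply cderiv_const].
Qed.

Section Derivative.
Variables f f' : C -> C.
Hypothesis Hf : forall z, cderiv f z (f' z).

Lemma holomorphic_of_cderiv : holomorphic f.
Proof. intros z; eexists; apply Hf. Qed.

Lemma derivative_bounded (rho : R) :
  exists K, 0 < K /\ forall z, Cmod z <= rho -> Cmod (f' z)%C <= K.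
Proof.
  destruct (bounded_on_discs f (rho + 1) holomorphic_of_cderiv) as [B [HB0 HB]].
  exists (8 * B); split; [lra|]; intros z Hz.
  replace (8 * B) with (8 * B / 1) by field.
  apply (cauchy_estimate f z); auto using holomorphic_of_cderiv; [lra|].
  intros w Hw; apply HB; pose proof (Cmod_le_add_sub w z); lra.
Qed.

Lemma lipschitz_on_discs (rho : R) : exists K, 0 < K /\ forall a b,
  Cmod a <= rho -> Cmod b <= rho -> Cmod (f b - f a)%C <= K * Cmod (b - a)%C.
Proof.
  destruct (derivative_bounded rho) as [K [K0 HK]]; exists K; split; auto.
  intros a b Ha Hb; apply (mean_value_inequality f f'); auto.
  intros t Ht; apply HK, Cmod_segment; auto.
Qed.

(** Cauchy's estimate applied to the increment [z |-> f (z + (b - a)) - f z], which is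
    small because [f] is Lipschitz and whose derivative at [a] is [f' b - f' a]. *)
Lemma derivative_lipschitz (rho : R) : exists L, 0 < L /\ forall a b,
  Cmod a <= rho -> Cmod b <= rho -> Cmod (f' b - f' a)%C <= L * Cmod (b - a)%C.
Proof.
  destruct (lipschitz_on_discs (3 * rho + 1)) as [K [K0 HK]].
  exists (8 * K); split; [lra|]; intros a b Ha Hb.
  pose proof (Cmod_ge_0 a).
  replace (8 * K * Cmod (b - a)%C) with (8 * (K * Cmod (b - a)%C) / 1) by field.
  apply (cauchy_estimate (fun z => f (z + (b - a)) - f z)%C a); [| |lra|].
  - apply holomorphic_minus; [apply holomorphic_shift|]; apply holomorphic_of_cderiv.
  - apply cderiv_minus; auto; apply cderiv_shift; rewrite Cplus_minus; auto.
  - intros z Hz; pose proof (Cmod_le_add_sub z a).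
    replace (K * Cmod (b - a)%C) with (K * Cmod (z + (b - a) - z)%C)
      by (do 2 f_equal; ring).
    apply HK; [lra|].
    pose proof (Cmod_triangle3 z b (- a)%C) as Q; rewrite Cmod_opp in Q.
    replace (z + (b - a))%C with (z + b + - a)%C by ring; lra.
Qed.

Lemma quadratic_taylor (rho : R) : exists L, 0 < L /\ forall q h,
  Cmod q <= rho -> Cmod h <= 1 ->
  Cmod (f (q + h) - f q - f' q * h)%C <= L * Cmod h ^ 2.
Proof.
  destruct (derivative_lipschitz (rho + 1)) as [L [L0 HL]].
  exists L; split; auto; intros q h Hq Hh.
  assert (Q := mean_value_inequality (fun z => f z - f' q * z)%C
    (fun z => f' z - f' q * 1)%C q (q + h) (L * Cmod h)).
  replace (f (q + h) - f q - f' q * h)%C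
    with (f (q + h) - f' q * (q + h) - (f q - f' q * q))%C by ring.
  replace (q + h - q)%C with h in Q by ring.
  replace (L * Cmod h ^ 2) with (L * Cmod h * Cmod h) by ring; apply Q; clear Q.
  - intros z; apply cderiv_minus; auto; apply cderiv_scal, cderiv_id.
  - intros t Ht; rewrite Cmult_1_r.
    assert (E : Cmod (t * h)%C <= Cmod h).
    { rewrite Cmod_mult, Cmod_R, Rabs_right by lra; pose proof (Cmod_ge_0 h); nra. }
    apply Rle_trans with (L * Cmod (q + t * h - q)%C).
    + apply HL; [lra|]; pose proof (Cmod_triangle q (t * h)%C); lra.
    + replace (q + t * h - q)%C with (t * h)%C by ring.
      apply Rmult_le_compat_l; lra.
Qed.

End Derivative.

(** Completeness with an explicit rate; the factor [2] comes from taking the limits of the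
    real and imaginary parts separately. *)
Lemma C_complete_sequence (u : nat -> C) (b : nat -> R) : is_lim_seq b 0 ->
  (forall n m, (n <= m)%nat -> Cmod (u m - u n)%C <= b n) ->
  exists l, forall n, Cmod (l - u n)%C <= 2 * b n.
Proof.
  intros Hb Hu.
  assert (Part : forall part : C -> R,
    (forall z w, part (z - w)%C = part z - part w) ->
    (forall z, Rabs (part z) <= Cmod z) ->
    exists r, forall n, Rabs (r - part (u n)) <= b n).
  { intros part Pm Pb.
    assert (Cau : forall n m, (n <= m)%nat -> Rabs (part (u m) - part (u n)) <= b n).
    { intros n m Hnm; rewrite <- Pm.
      apply Rle_trans with (1 := Pb _); auto. }
    assert (Ex : ex_finite_lim_seq (fun n => part (u n))).
    { apply ex_lim_seq_cauchy_corr; intros eps.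
      apply is_lim_seq_spec in Hb; simpl in Hb.
      destruct (Hb (pos_div_2 eps)) as [N HN].
      exists N; intros n m Hn Hm.
      pose proof (HN N (Nat.le_refl N)) as K; apply Rabs_lt_between in K; simpl in K.
      pose proof (Cau N n Hn) as K1; pose proof (Cau N m Hm) as K2.
      apply Rabs_le_between in K1; apply Rabs_le_between in K2.
      apply Rabs_lt_between; lra. }
    destruct Ex as [r Hr]; exists r; intros n; apply Rabs_le.
    assert (T : forall c, is_lim_seq (fun m => part (u (m + n)%nat) - c) (r - c)).
    { intros c; apply is_lim_seq_minus'; [|apply is_lim_seq_const].
      apply (is_lim_seq_incr_n (fun m => part (u m))), Hr. }
    assert (W : forall m, - b n <= part (u (m + n)%nat) - part (u n) <= b n).
    { intros m; apply Rabs_le_between, Cau; lia. }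
    split.
    - apply (is_lim_seq_le (fun _ => - b n) _ (- b n) _ (fun m => proj1 (W m))
        (is_lim_seq_const _) (T _)).
    - apply (is_lim_seq_le _ (fun _ => b n) _ (b n) (fun m => proj2 (W m))
        (T _) (is_lim_seq_const _)). }
  destruct (Part Re) as [x Hx].
  { intros; unfold Cminus; rewrite re_plus, re_opp; ring. } { apply re_le_Cmod. }
  destruct (Part Im) as [y Hy].
  { intros; unfold Cminus; rewrite im_plus, im_opp; ring. } { apply im_le_Cmod. }
  exists (x, y); intros n; specialize (Hx n); specialize (Hy n).
  apply Rle_trans with (1 := Cmod_le_Re_Im _).
  change (Rabs (x - Re (u n)) + Rabs (y - Im (u n)) <= 2 * b n); lra.
Qed.

Lemma is_lim_seq_inv_S : is_lim_seq (fun n => / INR (S n)) 0.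
Proof.
  apply (is_lim_seq_inv (fun n => INR (S n)) p_infty); [|discriminate].
  apply (is_lim_seq_incr_1 INR), is_lim_seq_INR.
Qed.

(** The difference quotients [q w = (f (z + w) - f z) / w] are themselves holomorphic in
    [z] and by [quadratic_taylor] uniformly within [O(w)] of [f']. Cauchy's estimate
    then makes their derivatives at [p], which are the difference quotients of [f'], a
    Cauchy family as [w] tends to [0]. *)
Lemma holomorphic_derivative (f f' : C -> C) :
  (forall z, cderiv f z (f' z)) -> holomorphic f'.
Proof.
  intros Hf p.
  destruct (quadratic_taylor f f' Hf (Cmod p + 1)) as [L [L0 HL]].
  pose (q := fun w z => ((f (z + w) - f z) / w)%C).
  pose (D := fun w => ((f' (p + w) - f' p) / w)%C).
  assert (Hq : forall w z : C, w <> 0 -> Cmod w <= 1 -> Cmod (z - p)%C <= 1 ->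
     Cmod (q w z - f' z)%C <= L * Cmod w).
  { intros w z Hw Hw1 Hz; pose proof (proj1 (Cmod_gt_0 w) Hw).
    unfold q; replace ((f (z + w) - f z) / w - f' z)%C
      with ((f (z + w) - f z - f' z * w) / w)%C by (field; auto).
    rewrite Cmod_div by auto; apply Rle_div_l; auto.
    rewrite Rmult_assoc; replace (Cmod w * Cmod w) with (Cmod w ^ 2) by ring.
    apply HL; auto; pose proof (Cmod_le_add_sub z p); lra. }
  assert (HD : forall w v : C, w <> 0 -> v <> 0 -> Cmod w <= 1 -> Cmod v <= 1 ->
     Cmod (D w - D v)%C <= 8 * L * (Cmod w + Cmod v)).
  { intros w v Hw Hv Hw1 Hv1.
    replace (8 * L * (Cmod w + Cmod v)) with (8 * (L * (Cmod w + Cmod v)) / 1) by field.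
    assert (Cq : forall u z : C, u <> 0 -> cderiv (q u) z ((f' (z + u) - f' z) / u)%C).
    { intros u z Hu; apply (cderiv_ext (fun z => / u * (f (z + u) - f z))%C).
      - intros; unfold q, Cdiv; ring.
      - apply (cderiv_eq _ _ (/ u * (f' (z + u) - f' z))%C); [unfold Cdiv; ring|].
        apply cderiv_scal, cderiv_minus; auto; now apply cderiv_shift. }
    apply (cauchy_estimate (fun z => q w z - q v z)%C p); [| |lra|].
    - intros z; eexists; apply cderiv_minus; auto.
    - apply cderiv_minus; now apply Cq.
    - intros z Hz; pose proof (Hq w z Hw Hw1 Hz); pose proof (Hq v z Hv Hv1 Hz).
      pose proof (Cmod_sub_triangle (q w z)%C (f' z)%C (q v z)%C).
      rewrite (Cmod_minus_sym (f' z)) in *; lra. }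
  assert (Hn : forall n, RtoC (/ INR (S n)) <> 0 /\ Cmod (/ INR (S n))%R = / INR (S n)
     /\ / INR (S n) <= 1).
  { intros n; pose proof (lt_0_INR (S n) ltac:(lia)) as P.
    pose proof (Rinv_0_lt_compat _ P) as Q; repeat split.
    - intros E; apply RtoC_inj in E; lra.
    - rewrite Cmod_R, Rabs_right; lra.
    - rewrite <- Rinv_1; apply Rinv_le_contravar; [lra|].
      apply (le_INR 1); lia. }
  destruct (C_complete_sequence (fun n => D (/ INR (S n))%R)
    (fun n => 16 * L * / INR (S n))) as [l Hl].
  { replace (Finite 0) with (Rbar_mult (16 * L) 0) by (simpl; f_equal; ring).
    apply is_lim_seq_scal_l, is_lim_seq_inv_S. }
  { intros n m Hnm; destruct (Hn n) as [N1 [N2 N3]], (Hn m) as [M1 [M2 M3]].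
    apply Rle_trans with (1 := HD _ _ M1 N1 ltac:(lra) ltac:(lra)).
    rewrite N2, M2.
    assert (/ INR (S m) <= / INR (S n)).
    { apply Rinv_le_contravar; [apply lt_0_INR; lia|apply le_INR; lia]. }
    nra. }
  exists l; intros eps Heps.
  exists (Rmin 1 (eps / (8 * L))); split.
  { apply Rmin_pos; [lra|apply Rdiv_lt_0_compat; lra]. }
  intros w Hw.
  pose proof (Rmin_l 1 (eps / (8 * L))); pose proof (Rmin_r 1 (eps / (8 * L))).
  destruct (Ceq_dec w 0) as [->|Nw].
  { replace (f' (p + 0) - f' p - l * 0)%C with (RtoC 0) by (rewrite Cplus_0_r; ring).
    rewrite Cmod_0; lra. }
  pose proof (proj1 (Cmod_gt_0 w) Nw).
  assert (K : Cmod (D w - l)%C <= 8 * L * Cmod w).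
  { apply (is_lim_seq_le (fun _ => Cmod (D w - l)%C)
      (fun n => 8 * L * Cmod w + 40 * L * / INR (S n)) (Cmod (D w - l)%C) (8 * L * Cmod w)).
    - intros n; destruct (Hn n) as [N1 [N2 N3]].
      pose proof (HD w _ Nw N1 ltac:(lra) ltac:(lra)) as K1; rewrite N2 in K1.
      pose proof (Hl n) as K2; rewrite Cmod_minus_sym in K2.
      pose proof (Cmod_sub_triangle (D w)%C (D (/ INR (S n))%R)%C l); lra.
    - apply is_lim_seq_const.
    - replace (Finite (8 * L * Cmod w)) with
        (Rbar_plus (8 * L * Cmod w) (Rbar_mult (40 * L) 0)) by (simpl; f_equal; ring).
      apply is_lim_seq_plus'; [apply is_lim_seq_const|].
      replace (40 * L * 0) with 0 by ring.
      replace (Finite 0) with (Rbar_mult (40 * L) 0) by (simpl; f_equal; ring).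
      apply is_lim_seq_scal_l, is_lim_seq_inv_S. }
  replace (f' (p + w) - f' p - l * w)%C with ((D w - l) * w)%C
    by (unfold D; field; auto).
  rewrite Cmod_mult; apply Rmult_le_compat_r; [lra|].
  apply Rle_trans with (1 := K).
  assert (Hw' : Cmod w < eps / (8 * L)) by lra.
  apply Rlt_div_r in Hw'; lra.
Qed.

(** * Primitives, logarithms and a Liouville theorem *)

Lemma holomorphic_choice (f : C -> C) : holomorphic f ->
  exists f', forall z, cderiv f z (f' z).
Proof. intros Hf; apply (choice (fun z l => cderiv f z l)); exact Hf. Qed.

Lemma is_derive_Re_real (f : C -> C) (l : C) (t : R) : cderiv f t l ->
  is_derive (fun u : R => Re (f u)%C) t (Re l).
Proof.
  intros H; apply (is_derive_ext (fun u : R => Re (f (0 + u * 1))%C)).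
  { intros u; do 2 f_equal; ring. }
  replace (Re l) with (Re (l * 1)%C) by (f_equal; ring).
  apply is_derive_Re_line; replace (0 + t * 1)%C with (RtoC t) by ring; auto.
Qed.

Lemma continuous_Re_real (f : C -> C) (t : R) : holomorphic f ->
  continuous (fun u : R => Re (f u)%C) t.
Proof.
  intros Hf; destruct (Hf t) as [l Hl].
  apply (ex_derive_continuous (fun u : R => Re (f u)%C)).
  eexists; apply is_derive_Re_real, Hl.
Qed.

Lemma ex_RInt_Re_real (f : C -> C) (a b : R) : holomorphic f ->
  ex_RInt (fun u : R => Re (f u)%C) a b.
Proof.
  intros Hf; apply (ex_RInt_continuous (V := R_CompleteNormedModule)); intros v _.
  now apply continuous_Re_real.
Qed.

(** The real part of the integral of [k] along the segment from [0] to [z]. *)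
Definition Re_primitive (k : C -> C) (z : C) : R :=
  RInt (fun t : R => Re (z * k (t * z))%C) 0 1.

(** To first order in [h] the integrand changes by the real part of
    [h * (k (t * z) + t * z * k' (t * z))], the [t]-derivative of [h * (t * k (t * z))],
    whose integral over [[0, 1]] is [h * k z]; [quadratic_taylor] bounds the rest. *)
Lemma Re_primitive_quadratic (k : C -> C) (z : C) : holomorphic k ->
  exists K, 0 < K /\ forall h, Cmod h <= 1 ->
    Rabs (Re_primitive k (z + h) - Re_primitive k z - Re (k z * h)%C) <= K * Cmod h ^ 2.
Proof.
  intros Hk; destruct (holomorphic_choice k Hk) as [k' Hk'].
  assert (Hk'' : holomorphic k') by (eapply holomorphic_derivative; eauto).
  destruct (quadratic_taylor k k' Hk' (Cmod z)) as [L [L0 HL]].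
  destruct (bounded_on_discs k' (Cmod z) Hk'') as [B [B0 HB]].
  pose proof (Cmod_ge_0 z) as z0.
  exists ((Cmod z + 1) * L + B); split; [nra|]; intros h Hh.
  assert (Hsc : forall w, holomorphic (fun s => s * w)%C)
    by (intros; apply holomorphic_mult; auto using holomorphic_id, holomorphic_const).
  assert (Hc : forall w, holomorphic (fun s => k (s * w)%C))
    by (intros w; apply (holomorphic_comp k (fun s => s * w)%C); auto).
  assert (Hint : forall w, ex_RInt (fun t : R => Re (w * k (t * w))%C) 0 1).
  { intros w; apply (ex_RInt_Re_real (fun s => w * k (s * w))%C).
    apply holomorphic_mult; auto using holomorphic_const. }
  set (d := fun s => (h * (k (s * z) + s * (k' (s * z) * z)))%C).
  assert (Hd : holomorphic d).
  { unfold d; apply holomorphic_mult; [apply holomorphic_const|].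
    apply holomorphic_plus; auto.
    apply holomorphic_mult; [apply holomorphic_id|].
    apply holomorphic_mult; [|apply holomorphic_const].
    apply (holomorphic_comp k' (fun s => s * z)%C); auto. }
  assert (I3 : is_RInt (fun t : R => Re (d t)%C) 0 1 (Re (k z * h)%C)).
  { replace (Re (k z * h)%C) with
      (minus (Re (h * (1 * k (1 * z)))%C) (Re (h * (0 * k (0 * z)))%C)).
    2:{ rewrite Cmult_1_l, Cmult_1_l, Cmult_0_l, Cmult_0_r, (Cmult_comm h (k z)).
        unfold minus, plus, opp; simpl; ring. }
    apply (is_RInt_derive (V := R_CompleteNormedModule)
      (fun t : R => Re (h * (t * k (t * z)))%C) (fun t : R => Re (d t)%C)); intros t _.
    - apply (is_derive_Re_real (fun s => h * (s * k (s * z)))%C).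
      apply cderiv_scal.
      apply (cderiv_eq _ _ (1 * k (t * z) + t * (k' (t * z) * (1 * z + t * 0)))%C);
        [ring|].
      apply (cderiv_mult (fun s => s) (fun s => k (s * z)%C)); [apply cderiv_id|].
      apply (cderiv_comp k (fun s => s * z)%C); auto.
      apply cderiv_mult; [apply cderiv_id|apply cderiv_const].
    - now apply continuous_Re_real. }
  assert (I : is_RInt (fun t : R => Re ((z + h) * k (t * (z + h)))%C - Re (z * k (t * z))%C
      - Re (d t)%C) 0 1 (Re_primitive k (z + h) - Re_primitive k z - Re (k z * h)%C)).
  { apply (is_RInt_minus (V := R_NormedModule)); auto.
    apply (is_RInt_minus (V := R_NormedModule));
      apply (RInt_correct (V := R_CompleteNormedModule)); auto. }
  rewrite <- (is_RInt_unique _ _ _ _ I).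
  replace (((Cmod z + 1) * L + B) * Cmod h ^ 2)
    with ((1 - 0) * (((Cmod z + 1) * L + B) * Cmod h ^ 2)) by ring.
  apply abs_RInt_le_const; [lra|eexists; exact I|]; intros t Ht.
  assert (Htz : Cmod (t * z)%C <= Cmod z)
    by (rewrite Cmod_mult, Cmod_R, Rabs_right by lra; nra).
  assert (Hth : Cmod (t * h)%C <= Cmod h)
    by (rewrite Cmod_mult, Cmod_R, Rabs_right by lra; pose proof (Cmod_ge_0 h); nra).
  replace (Re ((z + h) * k (t * (z + h)))%C - Re (z * k (t * z))%C - Re (d t)%C)
    with (Re ((z + h) * (k (t * z + t * h) - k (t * z) - k' (t * z) * (t * h))
              + h * (t * h) * k' (t * z))%C).
  2:{ unfold d; replace (t * (z + h))%C with (t * z + t * h)%C by ring.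
      unfold Rminus; rewrite <- !re_opp, <- !re_plus; f_equal; ring. }
  apply Rle_trans with (1 := re_le_Cmod _).
  apply Rle_trans with (1 := Cmod_triangle _ _); rewrite !(Cmod_mult (z + h)%C), !Cmod_mult.
  specialize (HL (t * z)%C (t * h)%C Htz ltac:(lra)); specialize (HB _ Htz).
  rewrite Cmod_mult in Hth.
  pose proof (Cmod_triangle z h); pose proof (Cmod_ge_0 h); pose proof (Cmod_ge_0 (z + h)).
  pose proof (Cmod_ge_0 t).
  assert (S1 : Cmod (t * h)%C ^ 2 <= Cmod h ^ 2).
  { rewrite Cmod_mult; apply pow_incr; split; auto; apply Rmult_le_pos; auto. }
  assert (S2 : Cmod (z + h)%C
     * Cmod (k (t * z + t * h) - k (t * z) - k' (t * z) * (t * h))%C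
     <= (Cmod z + 1) * (L * Cmod h ^ 2)).
  { apply Rmult_le_compat; try apply Cmod_ge_0; [lra|].
    apply Rle_trans with (1 := HL); nra. }
  assert (S3 : Cmod h * (Cmod t * Cmod h) * Cmod (k' (t * z))%C <= Cmod h * Cmod h * B).
  { apply Rmult_le_compat; try apply Cmod_ge_0; auto.
    - repeat apply Rmult_le_pos; auto.
    - apply Rmult_le_compat_l; auto. }
  nra.
Qed.

Lemma primitive_exists (k : C -> C) : holomorphic k ->
  exists F, forall z, cderiv F z (k z).
Proof.
  intros Hk.
  assert (Hk2 : holomorphic (fun z => - Ci * k z)%C)
    by (apply holomorphic_mult; auto using holomorphic_const).
  exists (fun z => (Re_primitive k z, Re_primitive (fun z => - Ci * k z)%C z)).
  intros z eps Heps.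
  destruct (Re_primitive_quadratic k z Hk) as [K1 [P1 H1]].
  destruct (Re_primitive_quadratic _ z Hk2) as [K2 [P2 H2]].
  exists (Rmin 1 (eps / (K1 + K2))); split.
  { apply Rmin_pos; [lra|apply Rdiv_lt_0_compat; lra]. }
  intros h Hh.
  pose proof (Rmin_l 1 (eps / (K1 + K2))); pose proof (Rmin_r 1 (eps / (K1 + K2))).
  specialize (H1 h ltac:(lra)); specialize (H2 h ltac:(lra)).
  rewrite <- Cmult_assoc, <- Im_as_Re in H2.
  apply Rle_trans with (1 := Cmod_le_Re_Im _).
  cbv beta; set (a := Re_primitive k (z + h)) in *; set (b := Re_primitive k z) in *.
  set (k2 := fun z => (- Ci * k z)%C) in *.
  set (c := Re_primitive k2 (z + h)) in *; set (d := Re_primitive k2 z) in *.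
  change (Rabs (a - b - Re (k z * h)%C) + Rabs (c - d - Im (k z * h)%C) <= eps * Cmod h).
  assert (Q : Cmod h < eps / (K1 + K2)) by lra.
  apply Rlt_div_r in Q; [|lra]; pose proof (Cmod_ge_0 h); nra.
Qed.

Lemma constant_of_zero_derivative (f : C -> C) :
  (forall z, cderiv f z 0) -> forall z, f z = f 0.
Proof.
  intros Hf z; apply Ceq_minus, Cmod_eq_0, Rle_antisym; [|apply Cmod_ge_0].
  replace 0 with (0 * Cmod (z - 0)%C) at 2 by ring.
  apply (mean_value_inequality f (fun _ => 0)); auto; intros; rewrite Cmod_0; lra.
Qed.

(** With [F] a primitive of [f' / f], the function [f * Cexp (- F)] has zero derivative. *)
Lemma logarithm_exists (f : C -> C) : holomorphic f -> (forall z, f z <> 0) ->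
  exists g, holomorphic g /\ forall z, f z = Cexp (g z)%C.
Proof.
  intros Hf Nf; destruct (holomorphic_choice f Hf) as [f' Hf'].
  destruct (primitive_exists (fun z => f' z * / f z)%C) as [F HF].
  { apply holomorphic_mult; [eapply holomorphic_derivative; eauto|].
    intros z; eexists; apply (cderiv_comp Cinv f); [apply Hf'|apply cderiv_inv, Nf]. }
  assert (K : forall z, (f z * Cexp (0 - F z) = f 0 * Cexp (0 - F 0))%C).
  { apply (constant_of_zero_derivative (fun z => f z * Cexp (0 - F z))%C); intros z.
    apply (cderiv_eq _ _ (f' z * Cexp (0 - F z)
      + f z * (Cexp (0 - F z) * (0 - f' z * / f z)))%C).
    { field; apply Nf. }
    apply (cderiv_mult f (fun z => Cexp (0 - F z)%C)); auto.
    apply (cderiv_comp Cexp (fun z => 0 - F z)%C); [|apply cderiv_Cexp].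
    apply cderiv_minus; auto using cderiv_const. }
  destruct (Cexp_surj (f 0 * Cexp (0 - F 0)%C) 0) as [z0 [E0 _]].
  { apply Cmult_neq_0; [apply Nf|apply Cexp_neq_0]. }
  exists (fun z => z0 + F z)%C; split.
  - apply holomorphic_plus; [apply holomorphic_const|intros z; eexists; apply HF].
  - intros z; rewrite Cexp_plus, E0, <- (K z), <- Cmult_assoc, <- Cexp_plus.
    replace (0 - F z + F z)%C with (RtoC 0) by ring; rewrite Cexp_0; ring.
Qed.

(** Cauchy's estimate on discs of radius [T] bounds the derivative by a multiple of
    [1 / sqrt T]. The growth condition is written in the coordinate [s = log z], where
    [sqrt |z|] is [exp (Re s / 2)]. *)
Lemma liouville_sqrt_growth (g : C -> C) (K : R) : holomorphic g ->
  (forall s, 0 <= Re s -> Cmod (g (Cexp s))%C <= K * exp (Re s / 2)) ->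
  forall z, g z = g 0.
Proof.
  intros Hg HK; destruct (holomorphic_choice g Hg) as [g' Hg'].
  apply constant_of_zero_derivative; intros p.
  destruct (bounded_on_discs g 1 Hg) as [B [B0 HB]].
  assert (K0 : 0 <= K).
  { pose proof (HK 0 ltac:(simpl; lra)) as Q; simpl in Q.
    replace (0 / 2) with 0 in Q by field; rewrite exp_0 in Q.
    pose proof (Cmod_ge_0 (g (Cexp 0))); lra. }
  apply (cderiv_eq _ _ (g' p)); auto; apply Cmod_eq_0, Rle_antisym; [|apply Cmod_ge_0].
  apply le_epsilon; intros eps Heps; rewrite Rplus_0_l.
  pose proof (Cmod_ge_0 p) as p0.
  set (y := 2 * Cmod p + 32 * (K + B) / eps + 1).
  assert (Q0 : 0 <= 32 * (K + B) / eps) by (apply Rdiv_le_0_compat; lra).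
  assert (Hy : 0 < y) by (unfold y; lra).
  pose proof (exp_ineq1_le y) as E1; pose proof (exp_pos y) as E0.
  pose proof (exp_ineq1_le (y / 2)) as E2; pose proof (exp_pos (y / 2)) as E3.
  assert (EE : exp y = exp (y / 2) * exp (y / 2)) by (rewrite <- exp_plus; f_equal; field).
  assert (C1 : Cmod (g' p)%C <= 8 * ((K + B) * exp (y / 2)) / (exp y / 2)).
  { apply (cauchy_estimate g p); auto; [lra|]; intros z Hz.
    destruct (Rle_lt_dec (Cmod z) 1) as [H1|H1].
    { apply Rle_trans with (1 := HB z H1); nra. }
    destruct (Cexp_surj z 0) as [s [Es _]]; [apply Cmod_gt_0; lra|].
    pose proof (Cmod_Cexp s) as Ms; rewrite Es in Ms.
    pose proof (Cmod_le_add_sub z p).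
    assert (Rs : 0 <= Re s <= y).
    { split; apply Rnot_lt_le; intros N; apply exp_increasing in N;
        [rewrite exp_0 in N; lra|unfold y in *; lra]. }
    rewrite <- Es; apply Rle_trans with (1 := HK s (proj1 Rs)).
    assert (exp (Re s / 2) <= exp (y / 2)).
    { destruct (proj2 Rs) as [N|N]; [apply Rlt_le, exp_increasing; lra|].
      rewrite N; lra. }
    pose proof (exp_pos (Re s / 2)); nra. }
  apply Rle_trans with (1 := C1); rewrite EE.
  replace (8 * ((K + B) * exp (y / 2)) / (exp (y / 2) * exp (y / 2) / 2))
    with (16 * (K + B) / exp (y / 2)) by (field; lra).
  apply Rle_div_l; auto.
  assert (Q1 : 32 * (K + B) / eps <= y) by (unfold y; lra).
  apply Rle_div_l in Q1; nra.
Qed.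

(** * Rigidity in a strip and local surjectivity *)

Lemma gronwall_unit (y y' : R -> R) (k : R) :
  (forall t, is_derive y t (y' t)) -> (forall t, 0 <= t <= 1 -> y' t <= k * y t) ->
  y 1 <= y 0 * exp k.
Proof.
  intros Hy Hk.
  assert (D : forall t, is_derive (fun t => y t * exp (- (k * t))) t
     (y' t * exp (- (k * t)) + y t * (- k * exp (- (k * t))))).
  { intros t; apply (is_derive_mult y (fun t => exp (- (k * t)))); auto.
    - auto_derive; auto; ring.
    - intros; apply Rmult_comm. }
  destruct (MVT_gen (fun t => y t * exp (- (k * t))) 0 1
    (fun t => y' t * exp (- (k * t)) + y t * (- k * exp (- (k * t))))) as [c [Hc E]].
  - intros; apply D.
  - intros t _; apply continuity_pt_filterlim.
    apply (ex_derive_continuous (fun t => y t * exp (- (k * t)))); eexists; apply D.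
  - rewrite Rmin_left, Rmax_right in Hc by lra.
    replace (- (k * 0)) with 0 in E by ring; replace (- (k * 1)) with (- k) in E by ring.
    rewrite exp_0 in E; specialize (Hk c Hc).
    pose proof (exp_pos (- (k * c))) as P; pose proof (exp_pos k) as Q.
    assert (y 1 * exp (- k) <= y 0) by nra.
    replace (y 1) with (y 1 * exp (- k) * exp k)
      by (rewrite Rmult_assoc, <- exp_plus; replace (- k + k) with 0 by ring;
          rewrite exp_0; ring).
    apply Rmult_le_compat_r; lra.
Qed.

(** A function that attains its near-maximal real part [1] at [0] in a strip is nearly
    constant there. Along the segment from [0] to [s] the defect
    [y = 1 + eps - Re h] satisfies [|y'| <= 192 * y] by [borel_caratheodory] on
    discs of radius [1 / 8], so it stays below [eps * exp 192]. *)
Lemma strip_rigidity (eta : R) : 0 < eta -> exists eps, 0 < eps /\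
  forall h h' : C -> C, (forall z, cderiv h z (h' z)) -> h 0 = 1 ->
    (forall s, Rabs (Re s) <= 1 / 4 -> Re (h s)%C <= 1 + eps) ->
    forall s, Rabs (Re s) <= 1 / 8 -> Rabs (Im s) <= 5 -> Cmod (h' s)%C <= eta.
Proof.
  intros Heta; pose proof (exp_pos 192) as P.
  (* [32] is the constant of [borel_caratheodory] for radius [1 / 8], and [192 = 32 * 6]
     with [6] a bound for the length of the segments. *)
  exists (eta / (32 * exp 192)); split; [apply Rdiv_lt_0_compat; lra|].
  set (eps := eta / (32 * exp 192)); intros h h' Hh H0 HM s Hre Him.
  assert (BC : forall p, Rabs (Re p) <= 1 / 8 ->
    Cmod (h' p)%C <= 32 * (1 + eps - Re (h p)%C)).
  { intros p Hp; replace (32 * (1 + eps - Re (h p)%C))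
      with (4 * (1 + eps - Re (h p)%C) / (1 / 8)) by field.
    apply (borel_caratheodory h); auto; [now apply (holomorphic_of_cderiv h h')|lra|].
    intros z Hz; apply HM; pose proof (re_le_Cmod (z - p)%C) as K.
    unfold Cminus in K; rewrite re_plus, re_opp in K.
    replace (Re z) with (Re z + - Re p + Re p) by ring.
    apply Rle_trans with (1 := Rabs_triang _ _); unfold Cminus in Hz; lra. }
  assert (Hs : Cmod s <= 6) by (pose proof (Cmod_le_Re_Im s); lra).
  apply Rle_trans with (1 := BC s Hre).
  set (y := fun t : R => 1 + eps + - 1 * Re (h (0 + t * s))%C).
  assert (G := gronwall_unit y (fun t => 0 + - 1 * Re (h' (0 + t * s) * s)%C) 192).
  unfold y in G at 3 4; replace (0 + 0 * s)%C with (RtoC 0) in G by ring.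
  replace (0 + 1 * s)%C with s in G by ring; rewrite H0, re_RtoC in G.
  replace (1 + eps + -1 * 1) with eps in G by ring.
  enough (1 + eps + - 1 * Re (h s)%C <= eps * exp 192).
  { assert (32 * (eps * exp 192) = eta) by (unfold eps; field; lra); lra. }
  apply G; clear G.
  - intros t; apply (is_derive_plus (V := R_NormedModule)).
    + apply (is_derive_const (V := R_NormedModule)).
    + apply (is_derive_scal (fun t : R => Re (h (0 + t * s))%C)), is_derive_Re_line, Hh.
  - intros t Ht; unfold y.
    assert (E : Re (0 + t * s)%C = t * Re s) by (rewrite re_plus, re_scal_l; simpl; ring).
    assert (Hr : Rabs (Re (0 + t * s)%C) <= 1 / 8).
    { rewrite E, Rabs_mult, (Rabs_right t) by lra; pose proof (Rabs_pos (Re s)); nra. }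
    specialize (BC _ Hr); set (w := (0 + t * s)%C) in *.
    pose proof (re_le_Cmod (h' w * s)%C) as K; rewrite Cmod_mult in K.
    apply Rabs_le_between in K.
    pose proof (Cmod_ge_0 (h' w)); pose proof (Cmod_ge_0 s); nra.
Qed.

Lemma le_of_le_geom (a b K : R) : (forall n, a <= b + K * (/ 2) ^ n) -> a <= b.
Proof.
  intros H; apply (is_lim_seq_le (fun _ => a) (fun n => b + K * (/ 2) ^ n) a b H).
  - apply is_lim_seq_const.
  - replace (Finite b) with (Finite (b + K * 0)) by (f_equal; ring).
    apply is_lim_seq_plus'; [apply is_lim_seq_const|].
    apply (is_lim_seq_scal_l _ K 0), is_lim_seq_geom; rewrite Rabs_right; lra.
Qed.

(** Iteration from the centre; the [n]-th iterate is within [2 * r / 2 ^ n] of all later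
    ones. *)
Lemma contraction_fixed_point (Phi : C -> C) (c : C) (r : R) :
  (forall z, Cmod (z - c)%C <= r -> Cmod (Phi z - c)%C <= r) ->
  (forall z w, Cmod (z - c)%C <= r -> Cmod (w - c)%C <= r ->
     Cmod (Phi z - Phi w)%C <= / 2 * Cmod (z - w)%C) ->
  0 <= r -> exists z, Cmod (z - c)%C <= r /\ Phi z = z.
Proof.
  intros Hself Hcon Hr.
  set (u := fun n => Nat.iter n Phi c).
  assert (In : forall n, Cmod (u n - c)%C <= r).
  { induction n as [|n IH]; [|apply Hself, IH].
    unfold u; simpl; replace (c - c)%C with (RtoC 0) by ring; rewrite Cmod_0; lra. }
  assert (Near : forall n, Cmod (u (S n) - u n)%C <= r * (/ 2) ^ n).
  { induction n as [|n IH].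
    - rewrite Rmult_1_r; apply (In 1%nat).
    - apply Rle_trans with (1 := Hcon _ _ (In (S n)) (In n)).
      rewrite <- tech_pow_Rmult; lra. }
  assert (Cau : forall n k, Cmod (u (n + k)%nat - u n)%C
    <= 2 * r * (/ 2) ^ n - 2 * r * (/ 2) ^ (n + k)).
  { intros n; induction k as [|k IH].
    - rewrite Nat.add_0_r; replace (u n - u n)%C with (RtoC 0) by ring.
      rewrite Cmod_0; lra.
    - rewrite Nat.add_succ_r; pose proof (Near (n + k)%nat).
      pose proof (Cmod_sub_triangle (u (S (n + k))) (u (n + k)%nat) (u n)).
      simpl in *; lra. }
  assert (Pw : forall n, 0 < (/ 2) ^ n) by (intros; apply pow_lt; lra).
  destruct (C_complete_sequence u (fun n => 2 * r * (/ 2) ^ n)) as [l Hl].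
  { replace (Finite 0) with (Finite (2 * r * 0)) by (f_equal; ring).
    apply (is_lim_seq_scal_l _ (2 * r) 0), is_lim_seq_geom; rewrite Rabs_right; lra. }
  { intros n m Hnm; replace m with (n + (m - n))%nat by lia.
    pose proof (Pw (n + (m - n))%nat).
    apply Rle_trans with (1 := Cau _ _); nra. }
  assert (Il : Cmod (l - c)%C <= r).
  { apply (le_of_le_geom _ _ (4 * r)); intros n.
    pose proof (Hl n); pose proof (In n); pose proof (Cmod_sub_triangle l (u n)%C c); lra. }
  exists l; split; auto.
  apply Ceq_minus, Cmod_eq_0, Rle_antisym; [|apply Cmod_ge_0].
  apply (le_of_le_geom _ _ (6 * r)); intros n.
  pose proof (Hcon l (u n) Il (In n)) as K1; pose proof (Hl n) as K2.
  pose proof (Hl (S n)) as K3; rewrite Cmod_minus_sym in K3; simpl in K3.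
  change (Phi (u n)) with (u (S n)) in K1.
  pose proof (Cmod_sub_triangle (Phi l)%C (u (S n))%C l); unfold u in *; simpl in *.
  pose proof (Pw n); nra.
Qed.

(** When [h] is close to [1] with small derivative, [Cexp s * h s] still takes the value
    [Cexp s1] near [s1]: the map [s |-> s - (Cexp (s - s1) * h s - 1)], whose fixed
    points are the solutions, has derivative near [1 - Cexp (s - s1)], hence contracts
    a small disc about [s1]. *)
Lemma perturbed_exponential_onto (h h' : C -> C) (s1 : C) :
  (forall z, cderiv h z (h' z)) -> h 0 = 1 ->
  (forall s, Rabs (Re s) <= 1 / 8 -> Rabs (Im s) <= 5 -> Cmod (h' s)%C <= / 384) ->
  Rabs (Re s1) <= 1 / 16 -> Rabs (Im s1) <= 4 ->
  exists s, Cmod (s - s1)%C <= 1 / 16 /\ (Cexp s * h s)%C = Cexp s1.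
Proof.
  intros Hh H0 Hd Hre Him.
  assert (Box : forall s, Cmod (s - s1)%C <= 1 / 16 ->
     Rabs (Re s) <= 1 / 8 /\ Rabs (Im s) <= 5).
  { intros s Hs; pose proof (Re_minus_le s s1) as A; pose proof (Im_minus_le s s1) as B.
    apply Rabs_le_between in Hre; apply Rabs_le_between in Him.
    apply Rabs_le_between in A; apply Rabs_le_between in B.
    split; apply Rabs_le; lra. }
  assert (Near1 : forall s, Rabs (Re s) <= 1 / 8 -> Rabs (Im s) <= 5 ->
     Cmod (h s - 1)%C <= / 64).
  { intros s A B; rewrite <- H0.
    assert (Hs : Cmod (s - 0)%C <= 6).
    { replace (s - 0)%C with s by ring; pose proof (Cmod_le_Re_Im s); lra. }
    apply Rle_trans with (/ 384 * Cmod (s - 0)%C); [|lra].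
    apply (mean_value_inequality h h'); auto; intros t Ht.
    replace (0 + t * (s - 0))%C with (t * s)%C by ring.
    apply Hd; rewrite ?re_scal_l, ?im_scal_l, Rabs_mult, (Rabs_right t) by lra.
    - pose proof (Rabs_pos (Re s)); nra.
    - pose proof (Rabs_pos (Im s)); nra. }
  set (Phi := fun s => (s - (Cexp (s - s1) * h s - 1))%C).
  assert (HPhi : forall s,
    cderiv Phi s (1 - (Cexp (s - s1) * h s + Cexp (s - s1) * h' s))%C).
  { intros s; apply (cderiv_eq _ _
      (1 - (Cexp (s - s1) * (1 - 0) * h s + Cexp (s - s1) * h' s - 0))%C); [ring|].
    apply cderiv_minus; [apply cderiv_id|].
    apply cderiv_minus; [|apply cderiv_const].
    apply (cderiv_mult (fun s => Cexp (s - s1)%C) h); auto.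
    apply (cderiv_comp Cexp (fun s => s - s1)%C); [|apply cderiv_Cexp].
    apply cderiv_minus; [apply cderiv_id|apply cderiv_const]. }
  assert (HPhi' : forall s, Cmod (s - s1)%C <= 1 / 16 ->
    Cmod (1 - (Cexp (s - s1) * h s + Cexp (s - s1) * h' s))%C <= / 2).
  { intros s Hs; destruct (Box s Hs) as [A B].
    specialize (Near1 s A B); specialize (Hd s A B).
    pose proof (Cexp_near_0 (s - s1) ltac:(lra)) as N.
    set (u := (s - s1)%C) in *; pose proof (Cmod_ge_0 u).
    assert (N1 : Cmod (Cexp u - 1)%C <= 5 / 64).
    { pose proof (Cmod_le_add_sub (Cexp u - 1)%C u); nra. }
    replace (1 - (Cexp u * h s + Cexp u * h' s))%C
      with (- (Cexp u - 1) + - ((h s - 1) + h' s) + - ((Cexp u - 1) * ((h s - 1) + h' s)))%C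
      by ring.
    apply Rle_trans with (1 := Cmod_triangle3 _ _ _).
    rewrite !Cmod_opp, Cmod_mult.
    pose proof (Cmod_triangle (h s - 1)%C (h' s)%C).
    pose proof (Cmod_ge_0 (h s - 1 + h' s)); pose proof (Cmod_ge_0 (Cexp u - 1)); nra. }
  assert (Contr : forall z w, Cmod (z - s1)%C <= 1 / 16 -> Cmod (w - s1)%C <= 1 / 16 ->
     Cmod (Phi z - Phi w)%C <= / 2 * Cmod (z - w)%C).
  { intros z w Hz Hw.
    apply (mean_value_inequality Phi _ w z _ HPhi); intros t Ht; apply HPhi'.
    replace (w + t * (z - w) - s1)%C with ((w - s1) + t * ((z - s1) - (w - s1)))%C by ring.
    now apply Cmod_segment. }
  destruct (contraction_fixed_point Phi s1 (1 / 16)) as [s [Hs E]]; auto; [|lra|].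
  - intros z Hz.
    assert (C0 : Cmod (s1 - s1)%C <= 1 / 16)
      by (replace (s1 - s1)%C with (RtoC 0) by ring; rewrite Cmod_0; lra).
    pose proof (Contr z s1 Hz C0).
    destruct (Box s1 C0) as [A B]; specialize (Near1 s1 A B).
    assert (Cmod (Phi s1 - s1)%C <= / 64).
    { unfold Phi; replace (s1 - s1)%C with (RtoC 0) by ring; rewrite Cexp_0.
      replace (s1 - (1 * h s1 - 1) - s1)%C with (- (h s1 - 1))%C by ring.
      now rewrite Cmod_opp. }
    pose proof (Cmod_sub_triangle (Phi z)%C (Phi s1)%C s1); lra.
  - exists s; split; auto.
    assert (E1 : (Cexp (s - s1) * h s)%C = 1).
    { apply Ceq_minus; replace (Cexp (s - s1) * h s - 1)%C with (s - Phi s)%C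
        by (unfold Phi; ring); rewrite E; ring. }
    replace (Cexp s) with (Cexp s1 * Cexp (s - s1))%C
      by (rewrite <- Cexp_plus, Cplus_minus; reflexivity).
    rewrite <- Cmult_assoc, E1; ring.
Qed.

(** * Extremal points of entire functions *)

Lemma bernoulli (u : R) (N : nat) : 0 <= u <= 1 -> 1 - INR N * u <= (1 - u) ^ N.
Proof.
  intros Hu; induction N as [|N IH]; [simpl; lra|].
  rewrite S_INR, <- tech_pow_Rmult; pose proof (pos_INR N).
  assert (0 <= INR N * u * u) by (repeat apply Rmult_le_pos; lra).
  apply Rle_trans with ((1 - u) * (1 - INR N * u)); [nra|].
  apply Rmult_le_compat_l; lra.
Qed.

Lemma exp_mult_INR (N : nat) (v : R) : exp v ^ N = exp (INR N * v).
Proof.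
  induction N as [|N IH]; [simpl; rewrite Rmult_0_l, exp_0; auto|].
  rewrite <- tech_pow_Rmult, IH, <- exp_plus, S_INR; f_equal; ring.
Qed.

Lemma exp_le (x y : R) : x <= y -> exp x <= exp y.
Proof. intros [H| ->]; [apply Rlt_le, exp_increasing, H|lra]. Qed.

(** The barrier [x |-> - N * ln (X - x)] has slope [N / q] at distance [q] from [X], and is
    tangent to its linearisation up to [1 / N] on the interval of length comparable to
    the inverse of that slope. This scale invariance is the reason for choosing it. *)
Lemma barrier_ratio (q t : R) (N : nat) : 0 < q -> (1 <= N)%nat ->
  Rabs t <= q / (4 * INR N) ->
  q ^ N <= (q - t) ^ N * exp (INR N / q * t + / INR N).
Proof.
  intros Hq HN Ht; pose proof (le_INR 1 N HN) as N1; simpl in N1.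
  set (tau := t / q).
  assert (Et : t = tau * q) by (unfold tau; field; lra).
  assert (Htau : Rabs tau <= / (4 * INR N)).
  { unfold tau, Rdiv; rewrite Rabs_mult, Rabs_inv, (Rabs_right q) by lra.
    apply Rle_div_l; auto; unfold Rdiv in Ht; lra. }
  assert (I4 : / (4 * INR N) <= / 4) by (apply Rinv_le_contravar; lra).
  assert (Hn2 : 2 * INR N * tau ^ 2 <= / INR N).
  { rewrite <- (pow2_abs tau); pose proof (Rabs_pos tau).
    apply Rle_trans with (2 * INR N * (/ (4 * INR N)) ^ 2).
    - apply Rmult_le_compat_l; [lra|]; apply pow_incr; lra.
    - replace (2 * INR N * (/ (4 * INR N)) ^ 2) with (/ 8 * / INR N) by (field; lra).
      assert (0 < / INR N) by (apply Rinv_0_lt_compat; lra); lra. }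
  apply Rabs_le_between in Htau.
  set (v := tau + 2 * tau ^ 2).
  assert (Q : q <= (q - t) * exp v).
  { pose proof (exp_ineq1_le v) as K.
    replace (q - t) with (q * (1 - tau)) by (rewrite Et; ring).
    rewrite Rmult_assoc; rewrite <- (Rmult_1_r q) at 1.
    apply Rmult_le_compat_l; [lra|].
    apply Rle_trans with ((1 - tau) * (1 + v)); [unfold v; nra|].
    apply Rmult_le_compat_l; lra. }
  apply Rle_trans with (((q - t) * exp v) ^ N); [apply pow_incr; lra|].
  rewrite Rpow_mult_distr, exp_mult_INR; apply Rmult_le_compat_l.
  - apply pow_le; rewrite Et; nra.
  - apply exp_le; unfold v.
    replace (INR N / q * t) with (INR N * tau) by (unfold tau; field; lra); nra.
Qed.

(** In the coordinate [s = log z], let [s0] nearly maximise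
    [|g| * exp (- Re s / 2) * (X - Re s) ^ N] over [0 <= Re s < X]. Comparison with
    [s0] bounds [|g|] by the barrier, which near [s0] is exponential with rate
    [a = 1 / 2 + N / (X - Re s0)], over a width of order [1 / a].
    The factor [exp (- Re s / 2)] keeps [a] away from [0], so that this width stays
    bounded; since nonconstant functions outgrow [sqrt |z|], it does not prevent [|g|]
    from being large at [s0], nor [s0] from lying inside the domain. *)
Lemma extremal_point (g : C -> C) (eps K : R) : holomorphic g ->
  ~ (forall z, g z = g 0) -> 0 < eps -> 0 < K ->
  exists (s0 : C) (a : R), / 2 <= a /\ 0 <= Re s0 /\
    K * exp (Re s0 / 2) <= Cmod (g (Cexp s0))%C /\
    forall s, Rabs (Re s - Re s0) <= / (4 * a) ->
      Cmod (g (Cexp s))%C <= Cmod (g (Cexp s0))%C * exp (eps + a * (Re s - Re s0)).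
Proof.
  intros Hg Hnc Heps HK.
  destruct (INR_unbounded (2 / eps)) as [N HN].
  assert (Q0 : 0 < 2 / eps) by (apply Rdiv_lt_0_compat; lra).
  assert (HN1 : (1 <= N)%nat) by (destruct N; [simpl in HN; lra|lia]).
  pose proof (le_INR 1 N HN1) as N1; simpl in N1.
  assert (HNe : / INR N <= eps / 2).
  { replace (eps / 2) with (/ (2 / eps)) by (field; lra).
    apply Rinv_le_contravar; lra. }
  destruct (bounded_on_discs g (exp 1) Hg) as [B0 [B0pos HB0]].
  (* The excess over [K] pays for the barrier at [s1], the inexact maximum, and the bound
     [B0] near the origin, which keeps [Re s0] above [1]. *)
  set (K1 := 2 * exp (eps / 2) * (K + B0)).
  assert (Ex : exists s1, 0 <= Re s1 /\ K1 * exp (Re s1 / 2) < Cmod (g (Cexp s1))%C).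
  { apply NNPP; intros Nx; apply Hnc, (liouville_sqrt_growth g K1 Hg).
    intros s Hs; apply Rnot_lt_le; intros L; apply Nx; now exists s. }
  destruct Ex as [s1 [P1 L1]].
  (* So far out that the barrier costs at most a factor [2] at [s1]. *)
  set (X := 2 * INR N * Re s1 + 2).
  assert (X1 : Re s1 < X) by (unfold X; nra).
  destruct (bounded_on_discs g (exp X) Hg) as [B [Bpos HB]].
  set (Psi := fun s => Cmod (g (Cexp s))%C * exp (- (Re s / 2)) * (X - Re s) ^ N).
  destruct (completeness (fun r => exists s, 0 <= Re s < X /\ r = Psi s)) as [S [S1 S2]].
  { exists (B * 1 * X ^ N); intros r [s [Hs ->]]; unfold Psi.
    apply Rmult_le_compat.
    - apply Rmult_le_pos; [apply Cmod_ge_0|apply Rlt_le, exp_pos].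
    - apply pow_le; lra.
    - apply Rmult_le_compat; [apply Cmod_ge_0|apply Rlt_le, exp_pos| |].
      + apply HB; rewrite Cmod_Cexp; apply exp_le; lra.
      + rewrite <- exp_0; apply exp_le; lra.
    - apply pow_incr; lra. }
  { exists (Psi s1), s1; split; [lra|auto]. }
  assert (E1 : 1 < exp (eps / 2)) by (rewrite <- exp_0; apply exp_increasing; lra).
  assert (LP1 : K1 * (X ^ N / 2) <= Psi s1).
  { unfold Psi; apply Rmult_le_compat.
    - unfold K1; repeat apply Rmult_le_pos; lra.
    - apply Rmult_le_pos; [apply pow_le|]; lra.
    - apply Rmult_le_reg_r with (exp (Re s1 / 2)); [apply exp_pos|].
      rewrite Rmult_assoc, <- exp_plus.
      replace (- (Re s1 / 2) + Re s1 / 2) with 0 by ring; rewrite exp_0; lra.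
    - replace (X - Re s1) with (X * (1 - Re s1 / X)) by (field; lra).
      rewrite Rpow_mult_distr; apply Rmult_le_compat_l; [apply pow_le; lra|].
      assert (U : 0 <= Re s1 / X <= 1).
      { split; [apply Rdiv_le_0_compat; lra|apply Rle_div_l; lra]. }
      apply Rle_trans with (2 := bernoulli _ N U).
      enough (INR N * (Re s1 / X) <= / 2) by lra.
      replace (INR N * (Re s1 / X)) with (INR N * Re s1 / X) by (field; lra).
      apply Rle_div_l; [lra|unfold X; lra]. }
  assert (XN : 0 < X ^ N) by (apply pow_lt; lra).
  assert (K1pos : 0 < K1) by (unfold K1; repeat apply Rmult_lt_0_compat; lra).
  assert (Spos : 0 < S).
  { apply Rlt_le_trans with (Psi s1); [nra|].
    apply S1; exists s1; split; [lra|auto]. }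
  assert (Ex : exists s0, 0 <= Re s0 < X /\ S < exp (eps / 2) * Psi s0).
  { apply NNPP; intros Nx.
    assert (S <= S / exp (eps / 2)).
    { apply S2; intros r [s [Hs ->]]; apply (Rle_div_r (Psi s)); [lra|].
      apply Rnot_lt_le; intros L; apply Nx; exists s; split; auto; lra. }
    assert (S / exp (eps / 2) < S) by (apply Rlt_div_l; nra); lra. }
  destruct Ex as [s0 [R0 L0]].
  assert (Big : (K + B0) * exp (Re s0 / 2) <= Cmod (g (Cexp s0))%C).
  { assert (T : K1 * (X ^ N / 2) < exp (eps / 2) * Psi s0).
    { apply Rle_lt_trans with (2 := L0), Rle_trans with (1 := LP1).
      apply S1; exists s1; split; [lra|auto]. }
    replace (K1 * (X ^ N / 2)) with (exp (eps / 2) * ((K + B0) * X ^ N)) in T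
      by (unfold K1; field).
    apply Rmult_lt_reg_l in T; [|lra].
    assert (T2 : Psi s0 <= Cmod (g (Cexp s0))%C * exp (- (Re s0 / 2)) * X ^ N).
    { unfold Psi; apply Rmult_le_compat_l.
      - apply Rmult_le_pos; [apply Cmod_ge_0|apply Rlt_le, exp_pos].
      - apply pow_incr; lra. }
    assert (T3 : K + B0 < Cmod (g (Cexp s0))%C * exp (- (Re s0 / 2))).
    { apply Rmult_lt_reg_r with (X ^ N); lra. }
    apply Rlt_le in T3; apply Rmult_le_compat_r with (r := exp (Re s0 / 2)) in T3;
      [|apply Rlt_le, exp_pos].
    rewrite Rmult_assoc, <- exp_plus in T3.
    replace (- (Re s0 / 2) + Re s0 / 2) with 0 in T3 by ring; rewrite exp_0 in T3; lra. }
  pose proof (exp_pos (Re s0 / 2)) as Es0.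
  assert (R1 : 1 < Re s0).
  { apply Rnot_le_lt; intros L.
    assert (Cmod (g (Cexp s0))%C <= B0) by (apply HB0; rewrite Cmod_Cexp; now apply exp_le).
    pose proof (exp_ineq1_le (Re s0 / 2)); nra. }
  set (q := X - Re s0); assert (Hq : 0 < q) by (unfold q; lra).
  assert (Hnq : 0 < INR N / q) by (apply Rdiv_lt_0_compat; lra).
  exists s0, (/ 2 + INR N / q); split; [lra|]; split; [lra|]; split; [nra|].
  intros s Hs; set (t := Re s - Re s0) in *.
  set (a := / 2 + INR N / q) in *.
  assert (T1 : Rabs t <= / 2).
  { apply Rle_trans with (1 := Hs); apply Rinv_le_contravar; unfold a; lra. }
  assert (T2 : Rabs t <= q / (4 * INR N)).
  { apply Rle_trans with (1 := Hs).
    replace (q / (4 * INR N)) with (/ (4 * (INR N / q))) by (field; lra).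
    apply Rinv_le_contravar; unfold a; lra. }
  assert (T3 : q / (4 * INR N) <= q / 4).
  { unfold Rdiv; apply Rmult_le_compat_l; [lra|]; apply Rinv_le_contravar; lra. }
  assert (Rg : 0 <= Re s < X).
  { apply Rabs_le_between in T1; pose proof (Rle_abs t).
    assert (t <= q / 4) by lra; unfold t, q in *; lra. }
  assert (U : Psi s <= exp (eps / 2) * Psi s0).
  { apply Rle_trans with S; [|lra]; apply S1; exists s; split; auto. }
  unfold Psi in U; fold q in U.
  replace (X - Re s) with (q - t) in U by (unfold q, t; ring).
  pose proof (barrier_ratio q t N Hq HN1 T2) as BR.
  assert (D0 : 0 < (q - t) ^ N).
  { apply pow_lt; pose proof (Rle_abs t); lra. }
  set (A := Cmod (g (Cexp s))%C) in *; set (A0 := Cmod (g (Cexp s0))%C) in *.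
  assert (A0pos : 0 <= A0) by apply Cmod_ge_0.
  assert (U2 : A * exp (- (Re s / 2)) <=
     exp (eps / 2) * (A0 * exp (- (Re s0 / 2))) * exp (INR N / q * t + / INR N)).
  { apply Rmult_le_reg_r with ((q - t) ^ N); auto.
    apply Rle_trans with (1 := U).
    replace (exp (eps / 2) * (A0 * exp (- (Re s0 / 2)) * q ^ N))
      with (exp (eps / 2) * (A0 * exp (- (Re s0 / 2))) * q ^ N) by ring.
    rewrite (Rmult_assoc _ (exp (_ + _))), (Rmult_comm (exp (_ + _))).
    apply Rmult_le_compat_l; auto.
    repeat apply Rmult_le_pos; auto; try lra; apply Rlt_le, exp_pos. }
  apply Rmult_le_reg_r with (exp (- (Re s / 2))); [apply exp_pos|].
  apply Rle_trans with (1 := U2).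
  replace (exp (eps / 2) * (A0 * exp (- (Re s0 / 2))) * exp (INR N / q * t + / INR N))
    with (A0 * (exp (eps / 2) * exp (- (Re s0 / 2)) * exp (INR N / q * t + / INR N)))
    by ring.
  rewrite (Rmult_assoc A0); apply Rmult_le_compat_l; auto.
  rewrite <- !exp_plus; apply exp_le; unfold a, t in *; lra.
Qed.

(** * Covering annuli *)

(** Around an extremal point the function
    [h s = g (Cexp (s0 + s / a)) / (g (Cexp s0) * Cexp s)] has modulus at most [1 + e] in
    the strip [|Re s| <= 1 / 4] and equals [1] at [0], so by [strip_rigidity] it is
    nearly constant: [g (Cexp (s0 + s / a))] is close to [g (Cexp s0) * Cexp s], which
    covers an annulus of radius about [M = |g (Cexp s0)|] once [Im s] runs over an
    interval of length [2 * PI]. As [a >= 1 / 2], only points whose logarithm has real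
    part within [1 / 4] of [Re s0] are used. *)
Lemma annulus_image (g : C -> C) (K : R) : holomorphic g ->
  ~ (forall z, g z = g 0) -> 0 < K ->
  exists (x M : R), 0 <= x /\ K * exp (x / 2) <= M /\
    forall w, 31 / 32 * M <= Cmod w <= 17 / 16 * M ->
      exists s, Rabs (Re s - x) <= / 4 /\ g (Cexp s) = w.
Proof.
  intros Hg Hnc HK.
  destruct (strip_rigidity (/ 384)) as [e [He Rig]]; [lra|].
  assert (Hln : 0 < ln (1 + e)) by (rewrite <- ln_1; apply ln_increasing; lra).
  destruct (extremal_point g (ln (1 + e)) K Hg Hnc Hln HK) as [s0 [a [Ha [Hs0 [HM Ext]]]]].
  set (w0 := g (Cexp s0)) in *.
  exists (Re s0), (Cmod w0); split; [auto|]; split; [auto|]; intros w Hw.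
  assert (M0 : 0 < Cmod w0) by (pose proof (exp_pos (Re s0 / 2)); nra).
  assert (Nw0 : w0 <> 0) by (apply Cmod_gt_0; auto).
  assert (Na : RtoC a <> 0) by (intros E; apply RtoC_inj in E; lra).
  set (h := fun s => (g (Cexp (s0 + s * / a)) * (Cexp (0 - s) * / w0))%C).
  assert (Hh : holomorphic h).
  { unfold h; apply holomorphic_mult.
    - apply (holomorphic_comp g (fun s => Cexp (s0 + s * / a)%C)); auto.
      apply (holomorphic_comp Cexp (fun s => s0 + s * / a)%C holomorphic_Cexp).
      apply holomorphic_plus; [apply holomorphic_const|].
      apply holomorphic_mult; [apply holomorphic_id|apply holomorphic_const].
    - apply holomorphic_mult; [|apply holomorphic_const].
      apply (holomorphic_comp Cexp (fun s => 0 - s)%C holomorphic_Cexp).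
      apply holomorphic_minus; [apply holomorphic_const|apply holomorphic_id]. }
  destruct (holomorphic_choice h Hh) as [h' Hh'].
  assert (h0 : h 0 = 1).
  { unfold h; replace (s0 + 0 * / a)%C with s0 by ring; fold w0.
    replace (0 - 0)%C with (RtoC 0) by ring; rewrite Cexp_0; field; auto. }
  assert (Rescale : forall s, Re (s0 + s * / a)%C = Re s0 + Re s / a).
  { intros s; rewrite re_plus, <- RtoC_inv, re_scal_r by lra; reflexivity. }
  assert (hM : forall s, Rabs (Re s) <= 1 / 4 -> Re (h s)%C <= 1 + e).
  { intros s Hs; pose proof (re_le_Cmod (h s)%C) as Q; apply Rabs_le_between in Q.
    apply Rle_trans with (1 := proj2 Q); unfold h.
    rewrite !Cmod_mult, Cmod_Cexp, Cmod_inv by auto.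
    assert (E0 : Re (0 - s)%C = - Re s)
      by (unfold Cminus; rewrite re_plus, re_opp; simpl; ring).
    rewrite E0; specialize (Ext (s0 + s * / a)%C); rewrite Rescale in Ext.
    replace (Re s0 + Re s / a - Re s0) with (Re s / a) in Ext by ring.
    replace (a * (Re s / a)) with (Re s) in Ext by (field; lra).
    assert (Ext' : Cmod (g (Cexp (s0 + s * / a)))%C <= Cmod w0 * exp (ln (1 + e) + Re s)).
    { apply Ext; unfold Rdiv; rewrite Rabs_mult, Rabs_inv, (Rabs_right a) by lra.
      replace (/ (4 * a)) with (1 / 4 * / a) by (field; lra).
      apply Rmult_le_compat_r; auto; apply Rlt_le, Rinv_0_lt_compat; lra. }
    apply Rle_trans with (Cmod w0 * exp (ln (1 + e) + Re s) * (exp (- Re s) * / Cmod w0)).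
    - apply Rmult_le_compat_r; auto; apply Rmult_le_pos;
        [apply Rlt_le, exp_pos|apply Rlt_le, Rinv_0_lt_compat; auto].
    - replace (Cmod w0 * exp (ln (1 + e) + Re s) * (exp (- Re s) * / Cmod w0))
        with (exp (ln (1 + e) + Re s) * exp (- Re s)) by (field; lra).
      rewrite <- exp_plus; replace (ln (1 + e) + Re s + - Re s) with (ln (1 + e)) by ring.
      rewrite exp_ln; lra. }
  specialize (Rig h h' Hh' h0 hM).
  destruct (Cexp_surj (w / w0) (- PI)) as [s1 [Es1 Is1]].
  { apply Cmult_neq_0; [apply Cmod_gt_0; nra|].
    intros E; apply C1_nz; rewrite <- (Cinv_r w0), E by auto; ring. }
  assert (Rs1 : exp (Re s1) = Cmod w / Cmod w0)
    by (rewrite <- Cmod_Cexp, Es1, Cmod_div; auto).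
  assert (Bs1 : 31 / 32 <= exp (Re s1) <= 17 / 16).
  { rewrite Rs1; split; [apply (Rle_div_r (31 / 32))|apply (Rle_div_l (Cmod w))]; lra. }
  destruct (perturbed_exponential_onto h h' s1 Hh' h0 Rig) as [s [Hs Es]].
  - pose proof (exp_ineq1_le (1 / 16)) as B1.
    assert (B2 : exp (- (1 / 16)) <= 16 / 17).
    { rewrite exp_Ropp; replace (16 / 17) with (/ (17 / 16)) by field.
      apply Rinv_le_contravar; lra. }
    apply Rabs_le; split; apply Rnot_lt_le; intros L; apply exp_increasing in L; lra.
  - pose proof PI_4; apply Rabs_le; lra.
  - exists (s0 + s * / a)%C; rewrite Rescale; split.
    + replace (Re s0 + Re s / a - Re s0) with (Re s / a) by ring.
      pose proof (Re_minus_le s s1) as Q.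
      pose proof (exp_ineq1_le (Re s1)) as B1; pose proof (exp_ineq1_le (- Re s1)) as B2.
      assert (B3 : exp (- Re s1) <= 32 / 31).
      { rewrite exp_Ropp; replace (32 / 31) with (/ (31 / 32)) by field.
        apply Rinv_le_contravar; lra. }
      assert (Q2 : Rabs (Re s) <= 1 / 8)
        by (apply Rabs_le_between in Q; apply Rabs_le; lra).
      unfold Rdiv; rewrite Rabs_mult, Rabs_inv, (Rabs_right a) by lra.
      apply Rle_div_l; lra.
    + assert (P : (Cexp s * Cexp (0 - s))%C = 1)
        by (rewrite <- Cexp_plus, Cplus_minus; apply Cexp_0).
      rewrite Es1 in Es; unfold h in Es.
      assert (P2 : (g (Cexp (s0 + s * / a)) * (Cexp s * Cexp (0 - s)) / w0)%C = (w / w0)%C)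
        by (rewrite <- Es; unfold Cdiv; ring).
      rewrite P, Cmult_1_r in P2.
      replace w with (w / w0 * w0)%C by (field; auto).
      rewrite <- P2; field; auto.
Qed.

(** The solutions of [f z = w] are those of [g z = zeta + 2 * PI * k * Ci] with [g] a
    logarithm of [f]. The thin annulus of radius about [M] covered by [g] is crossed by the
    vertical line through [zeta], whose abscissa is of order [x = ln r], along an
    interval of length [M / 32], because [M] is a large multiple of [exp (x / 2)]; this
    is room for [n] of the points. They are [2 * PI] apart and [g] is Lipschitz, so their
    preimages are separated uniformly in [w]. *)
Lemma many_preimages (f : C -> C) (n : nat) : holomorphic f -> (forall z, f z <> 0) ->
  ~ (forall z, f z = f 0) ->
  exists delta r, 0 < delta /\ 0 < r /\ forall w, r / 2 < Cmod w < 2 * r ->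
    exists z : nat -> C,
      (forall i, (i < n)%nat -> r / 2 < Cmod (z i)%C < 2 * r /\ f (z i) = w) /\
      (forall i j, (i < n)%nat -> (j < n)%nat -> i <> j -> delta <= Cmod (z i - z j)%C).
Proof.
  intros Hf Nf Ncst; destruct (logarithm_exists f Hf Nf) as [g [Hg Efg]].
  assert (Hnc : ~ (forall z, g z = g 0)).
  { intros E; apply Ncst; intros z; now rewrite !Efg, E. }
  pose proof (pos_INR n) as n0; pose proof PI_4 as P4; pose proof PI2_3_2 as P3.
  (* [32] gives [16 * (x + 1) <= M], so real parts are negligible; [256 * INR n], with
     [PI <= 4], leaves room for [n] periods in [[31 / 32 * M, M]]. *)
  destruct (annulus_image g (32 + 256 * INR n) Hg Hnc) as [x [M [Hx [HM Img]]]]; [lra|].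
  set (r := exp x); assert (Hr : 0 < r) by apply exp_pos.
  destruct (holomorphic_choice g Hg) as [g' Hg'].
  destruct (lipschitz_on_discs g g' Hg' (2 * r)) as [L [L0 HL]].
  exists (/ L), r; split; [now apply Rinv_0_lt_compat|]; split; auto; intros w Hw.
  destruct (Cexp_surj w (31 / 32 * M)) as [zeta [Ez Iz]]; [apply Cmod_gt_0; lra|].
  assert (Rz : x - 1 <= Re zeta <= x + 1).
  { pose proof (Cmod_Cexp zeta) as Q; rewrite Ez in Q.
    pose proof (exp_ineq1_le 1) as E1.
    assert (E2 : exp (x + 1) = r * exp 1) by apply exp_plus.
    assert (E3 : exp (x - 1) = r / exp 1)
      by (unfold Rminus; rewrite exp_plus, exp_Ropp; reflexivity).
    assert (E4 : r / exp 1 <= r / 2)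
      by (apply Rmult_le_compat_l; [lra|apply Rinv_le_contravar; lra]).
    split; apply Rnot_lt_le; intros N; apply exp_increasing in N; nra. }
  assert (MB : 32 + 256 * INR n <= M /\ 16 * (x + 1) <= M).
  { pose proof (exp_ineq1_le (x / 2)); split; nra. }
  assert (Pre : forall i, exists z, (i < n)%nat ->
    r / 2 < Cmod z < 2 * r /\ g z = (zeta + (0%R, (2 * INR i * PI)%R))%C).
  { intros i; destruct (Nat.lt_ge_cases i n) as [Hi|Hi]; [|exists 0; lia].
    apply le_INR in Hi as Hin; rewrite S_INR in Hin; pose proof (pos_INR i).
    set (om := (zeta + (0%R, (2 * INR i * PI)%R))%C).
    assert (Eo : Re om = Re zeta /\ Im om = Im zeta + 2 * INR i * PI)
      by (unfold om; rewrite re_plus, im_plus; simpl; split; ring).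
    assert (Io : 31 / 32 * M <= Im om <= M) by (rewrite (proj2 Eo); split; nra).
    destruct (Img om) as [s [Hs Es]].
    - split.
      + pose proof (im_le_Cmod om) as Q; apply Rabs_le_between in Q; lra.
      + assert (Rabs (Re om) <= M / 16) by (rewrite (proj1 Eo); apply Rabs_le; lra).
        apply Rle_trans with (1 := Cmod_le_Re_Im _).
        rewrite (Rabs_right (Im om)) by lra; lra.
    - exists (Cexp s); intros _; split; auto; rewrite Cmod_Cexp.
      apply Rabs_le_between in Hs.
      replace (Re s) with (x + (Re s - x)) by ring; rewrite exp_plus; fold r.
      set (d := Re s - x) in *.
      pose proof (exp_ineq1_le d); pose proof (exp_ineq1_le (- d)) as Q.
      pose proof (exp_pos d).
      assert (exp d * exp (- d) = 1) by (rewrite <- exp_plus, Rplus_opp_r; apply exp_0).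
      assert (exp d <= 4 / 3) by nra.
      split; nra. }
  apply choice in Pre; destruct Pre as [z Hz]; exists z; split.
  - intros i Hi; destruct (Hz i Hi) as [A B]; split; auto.
    now rewrite Efg, B, Cexp_period.
  - intros i j Hi Hj Hij; destruct (Hz i Hi) as [A1 B1]; destruct (Hz j Hj) as [A2 B2].
    pose proof (HL (z j) (z i) ltac:(lra) ltac:(lra)) as Q; rewrite B1, B2 in Q.
    assert (Sep : 1 <= Cmod (zeta + (0%R, (2 * INR i * PI)%R)
                            - (zeta + (0%R, (2 * INR j * PI)%R)))%C).
    { match goal with |- _ <= Cmod ?d => pose proof (im_le_Cmod d) as T;
        replace (Im d) with (2 * PI * (INR i - INR j)) in T end.
      2:{ unfold Cminus; rewrite !im_plus, im_opp, im_plus; simpl; ring. }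
      apply Rle_trans with (2 := T); rewrite Rabs_mult, (Rabs_right (2 * PI)) by lra.
      assert (1 <= Rabs (INR i - INR j)); [|nra].
      destruct (Nat.lt_total i j) as [O|[O|O]]; [|lia|]; apply le_INR in O;
        rewrite S_INR in O; unfold Rabs; destruct Rcase_abs; lra. }
    apply Rmult_le_reg_l with L; auto; rewrite Rinv_r; lra.
Qed.

Theorem theorem1p1 (f : C -> C) (beta : C) (n : nat)
    (Hf : transcendental_entire f) (Hbeta : omitted_value f beta) :
  exists delta r : R,
    (0 < delta)%R /\ (0 < r)%R /\
    (forall w : C, annulus beta r w ->
       exists z : C, annulus beta r z /\ f z = w) /\
    (forall w : C, annulus beta r w ->
       exists z : nat -> C,
         (forall i : nat, (i < n)%nat -> annulus beta r (z i) /\ f (z i) = w) /\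
         (forall i j : nat, (i < n)%nat -> (j < n)%nat -> i <> j ->
            (delta <= Cmod (z i - z j))%R)).
Proof.
  destruct Hf as [Hent Hpol].
  set (f0 := fun z => (f (z + beta) - beta)%C).
  destruct (many_preimages f0 (S n)) as [delta [r [Hd [Hr Pre]]]].
  - apply holomorphic_minus; [|apply holomorphic_const].
    apply holomorphic_shift; intros z; destruct (Hent z) as [l Hl].
    exists l; now apply cderiv_of_is_derive.
  - intros z E; apply (Hbeta (z + beta)%C), Ceq_minus, E.
  - intros E; apply Hpol; exists 0%nat, (fun _ => f beta); intros z; rewrite sum_O.
    specialize (E (z - beta)%C); unfold f0 in E.
    replace (z - beta + beta)%C with z in E by ring.
    replace (0 + beta)%C with beta in E by ring.
    simpl; replace (f z) with (f z - beta + beta)%C by ring; rewrite E; ring.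
  - assert (Pre' : forall w, annulus beta r w -> exists z : nat -> C,
      (forall i, (i < S n)%nat -> annulus beta r (z i) /\ f (z i) = w) /\
      (forall i j, (i < S n)%nat -> (j < S n)%nat -> i <> j ->
         delta <= Cmod (z i - z j)%C)).
    { intros w Hw; destruct (Pre (w - beta)%C Hw) as [z [Hz Sep]].
      exists (fun i => z i + beta)%C; split.
      - intros i Hi; destruct (Hz i Hi) as [A B]; split.
        + unfold annulus; replace (z i + beta - beta)%C with (z i) by ring; exact A.
        + unfold f0 in B; replace (f (z i + beta)%C) with (f (z i + beta) - beta + beta)%C
            by ring; rewrite B; ring.
      - intros i j Hi Hj Hij.
        replace (z i + beta - (z j + beta))%C with (z i - z j)%C by ring; auto. }
    exists delta, r; split; auto; split; auto; split; intros w Hw;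
      destruct (Pre' w Hw) as [z [Hz Sep]].
    + exists (z 0%nat); apply Hz; lia.
    + exists z; split; [intros i Hi; apply Hz; lia|intros i j Hi Hj; apply Sep; lia].
Qed.
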